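(* Let $(\mathcal{X},\mathcal{P})$ be a good continuous latent variable model with dimension parameter $N$. Suppose that $\mathcal{X}$ satisfies Assumptions P1 and P2, that $\mathcal{P}$ satisfies Assumptions C1 and C2 (all defined in the context, with constants $A,B_2,B_4,B_6>0$), and that $k\ge D^2$, where $k\ge1$ and $D\ge0$ are integers. Then there are constants $C_1,C_2>0$ depending only on the channel $\mathcal{P}$ and on the constants $(A,B_2,B_4,B_6)$ such that $$C_1\,\mathsf{Univ}_{\le D}(\mathcal{X},1/F_{\mathcal{P}})\le\mathsf{CAdv}_{\le D}(\mathcal{D}_k\mathcal{X},\mathcal{P})^2\le C_2\,\mathsf{Univ}_{\le D}(\mathcal{X},1/F_{\mathcal{P}}).$$
   Context: $[N]=\{1,\dots,N\}$; $\exp^{\le D}(t)=\sum_{d=0}^D t^d/d!$. A continuous latent variable model (CLVM) $(\mathcal{X},\mathcal{P})$ consists of: a set $\Sigma\subseteq\mathbb{R}$ containing $0$; an integer $N\ge1$; a probability measure $\mathcal{X}$ on $\Sigma^N$ (the prior); and, for each $x\in\Sigma$, a probability measure $\mathcal{P}_x$ on a measurable space $\Omega$ (the channel $\mathcal{P}=(\mathcal{P}_x)_{x\in\Sigma}$, depending measurably on $x$). It defines two probability measures on $\Omega^N$: under $\mathbb{Q}$, the $y_i$ are i.i.d. with law $\mathcal{P}_0$; under $\mathbb{P}$, one first draws $x\sim\mathcal{X}$ and then draws $y_i\sim\mathcal{P}_{x_i}$ independently for $i\in[N]$. It is good if $\Sigma$ contains an open interval around zero and, for all $x\in\Sigma$,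 $\mathcal{P}_x\ll\mathcal{P}_0$ with $d\mathcal{P}_x/d\mathcal{P}_0\in L^2(\mathcal{P}_0)$. Channel overlap: $R_{\mathcal{P}}(x^{(1)},x^{(2)})=\mathbb{E}_{y\sim\mathcal{P}_0}\left[\left(\frac{d\mathcal{P}_{x^{(1)}}}{d\mathcal{P}_0}(y)-1\right)\left(\frac{d\mathcal{P}_{x^{(2)}}}{d\mathcal{P}_0}(y)-1\right)\right]$ for $x^{(1)},x^{(2)}\in\Sigma$. Coordinate advantage: for $T\subseteq[N]$, $V_T\subseteq L^2(\mathbb{Q})$ is the subspace of functions depending only on $y_T=(y_i)_{i\in T}$, $V_{\le D}=\sum_{|T|\le D}V_T$, and $\mathsf{CAdv}_{\le D}(\mathcal{X},\mathcal{P})=\max\{\mathbb{E}_{y\sim\mathbb{P}}f(y): f\in V_{\le D},\ \mathbb{E}_{y\sim\mathbb{Q}}f(y)^2\le1\}$. Assumptions on the prior, for $x\sim\mathcal{X}$ (almost surely): P1. $\|x\|_\infty\le A$. P2. For each $k'\in\{2,4,6\}$, $\|x\|_{k'}\le B_{k'}N^{\frac1{k'}-\frac14}$. Assumptions on the channel (with the same constant $A$): C1. $R_{\mathcal{P}}$ is $C^4$ in an open set containing $[-A,A]^2$ (so in particular $\mathcal{P}_x$ is defined for $x\in[-A,A]$). C2. $\frac{\partial^3R_{\mathcal{P}}}{\partial (x^{(1)})^2\,\partial x^{(2)}}(0,0)=0$. Fisher information: $F_{\mathcal{P}}=\frac{\partial^2R_{\mathcal{P}}}{\partial x^{(1)}\partial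 x^{(2)}}(0,0)$. For $\sigma^2>0$, $\mathsf{Univ}_{\le D}(\mathcal{X},\sigma^2)=\mathbb{E}_{x^{(1)},x^{(2)}\sim\mathcal{X}}\exp^{\le D}\left(\frac1{\sigma^2}\langle x^{(1)},x^{(2)}\rangle\right)$ with $x^{(1)},x^{(2)}$ independent; thus $\mathsf{Univ}_{\le D}(\mathcal{X},1/F_{\mathcal{P}})=\mathbb{E}\exp^{\le D}(F_{\mathcal{P}}\langle x^{(1)},x^{(2)}\rangle)$. Dilution: the $k$-dilution $\mathcal{D}_k\mathcal{X}$ is the law on vectors of length $kN$ obtained by drawing $x\sim\mathcal{X}$ and setting $\widetilde{x}=\frac1{\sqrt k}(x_1,\dots,x_1,\dots,x_N,\dots,x_N)$, each entry repeated $k$ times. $\mathsf{CAdv}_{\le D}(\mathcal{D}_k\mathcal{X},\mathcal{P})$ is the coordinate advantage of the CLVM with prior $\mathcal{D}_k\mathcal{X}$ (dimension $kN$) and the same channel. *)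

(* Defs.v *)
From HB Require Import structures.
From mathcomp Require Import all_boot all_order all_algebra.
From mathcomp Require Import all_classical all_reals all_analysis.
From mathcomp Require Import measurable_realfun giry.

Set Implicit Arguments.
Unset Strict Implicit.
Unset Printing Implicit Defensive.

Import Order.TTheory GRing.Theory Num.Theory.
Import numFieldNormedType.Exports.

Local Open Scope classical_set_scope.
Local Open Scope ring_scope.

Section product_law.
Context d (T : measurableType d) (R : realType).

Definition cons_pair n (p : T * n.-tuple T) : n.+1.-tuple T :=
  cons_tuple p.1 p.2.

Lemma measurable_cons_pair n : measurable_fun [set: T * n.-tuple T] (@cons_pair n).
Proof. exact: (@measurable_cons _ _ (T * n.-tuple T)%type T fst n snd). Qed.

HB.instance Definition _ n := isMeasurableFun.Build _ _ _ _ (@cons_pair n)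
  (@measurable_cons_pair n).

(* The law of (y_0, ..., y_{n-1}) with independent y_i ~ mu i; see
   prod_law_rect. *)
Fixpoint prod_law n : ('I_n -> probability T R) -> probability (n.-tuple T) R :=
  match n with
  | 0 => fun=> dirac [tuple]
  | m.+1 => fun mu =>
      distribution (mu ord0 \x prod_law (fun i => mu (lift ord0 i)))%E
                   (@cons_pair m)
  end.

Lemma prod_law_rect n (mu : 'I_n -> probability T R) (A : 'I_n -> set T) :
  (forall i, measurable (A i)) ->
  prod_law mu [set y | forall i, A i (tnth y i)] = (\prod_(i < n) mu i (A i))%E.
Proof.
elim: n mu A => [|n IH] mu A mA.
  rewrite big_ord0 /= diracE mem_set//; by case.
rewrite big_ord_recl -IH//=.
rewrite /distribution /pushforward.
rewrite [X in product_measure1 _ _ X](_ : _ =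
  A ord0 `*` [set y | forall i, A (lift ord0 i) (tnth y i)]); last first.
  apply/seteqP; split => -[a y] /=.
    move=> H; split; first by have := H ord0.
    by move=> i; have := H (lift ord0 i); rewrite tnthS.
  case=> H0 H i; case: (unliftP ord0 i) => [j ->|->//].
  by rewrite tnthS.
rewrite product_measure1E//.
have -> : [set y : n.-tuple T | forall i, A (lift ord0 i) (tnth y i)] =
   \bigcap_(i in [set: 'I_n]) ((@tnth n T)^~ i @^-1` A (lift ord0 i)).
  by apply/seteqP; split => y /= H i; [move=> _|]; exact: H.
apply: fin_bigcap_measurable => // i _.
by rewrite -[X in measurable X]setTI; exact: measurable_tnth.
Qed.

End product_law.

(* Only the laws [law x] with [x] in [signals] matter: the values of [law]
   elsewhere merely extend the family to all of R, for instance by law 0. *)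
Record channel d (Omega : measurableType d) (R : realType) := Channel {
  signals : set R ;
  law :> R -> probability Omega R ;
  signals0 : signals 0 ;
  measurable_law : forall U : set Omega, measurable U ->
    measurable_fun [set: R] (fun x => law x U) }.

Section model.
Context d (Omega : measurableType d) (R : realType).
Variable P : channel Omega R.

Definition null_law N : probability (N.-tuple Omega) R :=
  prod_law (fun=> P 0).

Definition obs_law N (x : N.-tuple R) : probability (N.-tuple Omega) R :=
  prod_law (fun i => P (tnth x i)).

Lemma measurable_obs_law N (A : set (N.-tuple Omega)) : measurable A ->
  measurable_fun [set: N.-tuple R] (fun x => obs_law x A).
Proof.
move=> mA.
suff H n (g : 'I_n -> 'I_N) (B : set (n.-tuple Omega)) : measurable B ->
    measurable_fun [set: N.-tuple R]
      (fun x : N.-tuple R => prod_law (fun i => P (tnth x (g i))) B).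
  exact: H.
elim: n g B => [|n IH] g B mB /=; first exact: measurable_cst.
have mC : measurable (@cons_pair _ Omega n @^-1` B).
  by rewrite -[X in measurable X]setTI; exact: measurable_cons_pair.
pose h (x : N.-tuple R) : giry Omega R * giry (n.-tuple Omega) R :=
  (P (tnth x (g ord0)) : giry Omega R,
   prod_law (fun i => P (tnth x (g (lift ord0 i)))) : giry (n.-tuple Omega) R).
have mh : measurable_fun [set: N.-tuple R] h.
  apply/measurable_fun_pairP; split; apply: measurable_giry_codensity => // U mU.
    apply: (@measurableT_comp _ _ _ _ _ _ (fun x => P x U)).
      exact: measurable_law.
    exact: measurable_tnth.
  exact: (IH (fun i => g (lift ord0 i))).
exact: (measurableT_comp (measurable_giry_ev mC)
  (measurableT_comp measurable_giry_prod mh)).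
Qed.

Section planted.
Variables (N : nat) (X : probability (N.-tuple R) R).
Local Open Scope ereal_scope.

Definition planted (A : set (N.-tuple Omega)) : \bar R :=
  \int[X]_x obs_law x A.

Let planted0 : planted set0 = 0.
Proof. by apply: integral0_eq => x _; rewrite measure0. Qed.

Let planted_ge0 A : 0 <= planted A.
Proof. by apply: integral_ge0 => x _; exact: measure_ge0. Qed.

Let planted_sigma_additive : semi_sigma_additive planted.
Proof.
move=> F mF tF mUF.
rewrite [X in _ --> X](_ : _ = \sum_(n <oo) planted (F n)).
  apply/cvg_closeP; split; last by rewrite closeE.
  by apply: is_cvg_nneseries => n _ _; exact: planted_ge0.
rewrite /planted -integral_nneseries//.
  by apply: eq_integral => x _; rewrite measure_semi_bigcup.
by move=> n; exact: measurable_obs_law.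
Qed.

HB.instance Definition _ := isMeasure.Build _ _ _ planted
  planted0 planted_ge0 planted_sigma_additive.

Let planted_setT : planted setT = 1.
Proof.
rewrite /planted (eq_integral (cst 1)); last first.
  by move=> x _; exact: probability_setT.
rewrite integral_cst// mul1e; exact: probability_setT.
Qed.

HB.instance Definition _ := Measure_isProbability.Build _ _ _ planted planted_setT.

End planted.

Definition likelihood_ratio (x : R) (y : Omega) : R :=
  fine (Radon_Nikodym (charge_of_finite_measure (P x)) (P 0) y).

Definition good : Prop :=
  (exists2 e : R, 0 < e & forall x, `|x| < e -> signals P x) /\
  (forall x, signals P x ->
    P x `<< P 0 /\ likelihood_ratio x \in Lfun (P 0) 2%:E).

Definition overlap (x1 x2 : R) : R :=
  fine 'E_(P 0%R)[fun y =>
    ((likelihood_ratio x1 y - 1) * (likelihood_ratio x2 y - 1))%R]%E.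

Section coordinate_advantage.
Variable N : nat.
Implicit Types (T : {set 'I_N}) (f : N.-tuple Omega -> R).

Definition depends_only_on T f : Prop :=
  forall y y' : N.-tuple Omega,
    (forall i, i \in T -> tnth y i = tnth y' i) -> f y = f y'.

Definition coord_space T : set (N.-tuple Omega -> R) :=
  [set f | f \in Lfun (null_law N) 2%:E /\ depends_only_on T f].

Definition coord_space_le (D : nat) : set (N.-tuple Omega -> R) :=
  [set f | exists2 g : {set 'I_N} -> N.-tuple Omega -> R,
     (forall T, (#|T| <= D)%N -> coord_space T (g T)) &
     f = (fun y => \sum_(T : {set 'I_N} | (#|T| <= D)%N) g T y)].

(* The maximum is rendered as an extended-real supremum: an unbounded family
   gives +oo instead of the default value 0 of sup on R. *)
Definition CAdv (D : nat) (X : probability (N.-tuple R) R) : \bar R :=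
  ereal_sup [set 'E_(planted X)[f]%E | f in
    [set f | coord_space_le D f /\
             ('E_(null_law N)[fun y => (f y ^+ 2)%R] <= 1)%E]].

Definition is_prior (X : probability (N.-tuple R) R) : Prop :=
  {ae X, forall x : N.-tuple R, forall i, signals P (tnth x i)}.

End coordinate_advantage.
End model.

Section calculus.
Context (R : realType).
Implicit Types (U : set (R * R)) (f : R -> R -> R).

Definition pd1 f : R -> R -> R := fun a b => derive1 (f^~ b) a.
Definition pd2 f : R -> R -> R := fun a b => derive1 (f a) b.

Fixpoint Ck (n : nat) U f : Prop :=
  (forall p, U p -> {for p, continuous (fun q : R * R => f q.1 q.2)}) /\
  match n with
  | 0 => True
  | m.+1 =>
      [/\ forall p, U p ->
            derivable (f^~ p.2) p.1 1 /\ derivable (f p.1) p.2 1,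
          Ck m U (pd1 f) & Ck m U (pd2 f)]
  end.

End calculus.

Section channel_assumptions.
Context d (Omega : measurableType d) (R : realType).
Variable P : channel Omega R.

(* The overlap is only meaningful on the square of the signal set, whence the
   inclusion of U in that square. *)
Definition assumption_C1 (A : R) : Prop :=
  exists U : set (R * R),
    [/\ open U, `[- A, A] `*` `[- A, A] `<=` U,
        U `<=` signals P `*` signals P & Ck 4 U (overlap P)].

Definition assumption_C2 : Prop := pd1 (pd1 (pd2 (overlap P))) 0 0 = 0.

Definition Fisher : R := pd1 (pd2 (overlap P)) 0 0.

End channel_assumptions.

Section priors.
Context (R : realType) (N : nat).
Implicit Types (x : N.-tuple R) (X : probability (N.-tuple R) R).

Definition norm_inf x : R := \big[Num.max/0]_(i < N) `|tnth x i|.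

Definition norm_l (p : nat) x : R :=
  (\sum_(i < N) `|tnth x i| ^+ p) `^ p%:R^-1.

Definition dotp x x' : R := \sum_(i < N) tnth x i * tnth x' i.

Definition assumption_P1 (A : R) X : Prop :=
  {ae X, forall x : N.-tuple R, norm_inf x <= A}.

Definition norm_bound (p : nat) (B : R) X : Prop :=
  {ae X, forall x : N.-tuple R,
     norm_l p x <= B * N%:R `^ (p%:R^-1 - 4^-1)}.

Definition assumption_P2 (B2 B4 B6 : R) X : Prop :=
  [/\ norm_bound 2 B2 X, norm_bound 4 B4 X & norm_bound 6 B6 X].

Definition exp_le (D : nat) (t : R) : R := \sum_(d < D.+1) t ^+ d / (d`!)%:R.

(* With sigma2 := F^-1 the factor sigma2^-1 is F, also when F = 0. *)
Definition Univ (D : nat) X (sigma2 : R) : \bar R :=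
  'E_(X \x X)[fun p => exp_le D (sigma2^-1 * dotp p.1 p.2)%R]%E.

Section dilution.
Variable k : nat.

Lemma dilution_index_subproof (j : 'I_(k * N)) : (j %/ k < N)%N.
Proof.
have kN0 : (0 < k * N)%N by exact: leq_ltn_trans (ltn_ord j).
have k0 : (0 < k)%N by move: kN0; rewrite muln_gt0 => /andP[].
by rewrite ltn_divLR// [X in (_ < X)%N]mulnC.
Qed.

Definition dilution_index (j : 'I_(k * N)) : 'I_N :=
  Ordinal (dilution_index_subproof j).

Definition dilute x : (k * N).-tuple R :=
  [tuple (Num.sqrt k%:R)^-1 * tnth x (dilution_index j) | j < k * N].

Lemma measurable_dilute : measurable_fun [set: N.-tuple R] dilute.
Proof.
apply/measurable_fun_tnthP => j.
rewrite (_ : _ \o _ =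
    (fun x : N.-tuple R => (Num.sqrt k%:R)^-1 * tnth x (dilution_index j))).
  by apply: measurable_funM => //; exact: measurable_tnth.
by apply/funext => x /=; rewrite tnth_mktuple.
Qed.

HB.instance Definition _ := isMeasurableFun.Build _ _ _ _ dilute measurable_dilute.

Definition dilution X : probability ((k * N).-tuple R) R := distribution X dilute.

End dilution.
End priors.

(* Main.v *)
Require Import Defs.
From mathcomp Require Import all_boot all_order all_algebra.
From mathcomp Require Import all_classical all_reals all_analysis.
From mathcomp Require Import measurable_realfun giry ring lra.

Set Implicit Arguments.
Unset Strict Implicit.
Unset Printing Implicit Defensive.

(** Let [h x] be the likelihood ratio of [P x] to [P 0], minus one. Under the null
law the functions [prod_(i in T) h (x i) (y i)], for [T] a set of coordinates,
are orthogonal for distinct [T], and their inner products at two signals are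
[prod_(i in T)] of the channel overlaps. The likelihood ratio of the whole
observation is the sum of all of them, and the functions of coordinate degree at
most [D] only see the sets of size at most [D] ([ip_prod_density]). Hence the
square of the coordinate advantage is the squared norm of the prior mean of this
truncated sum, which is the mean over two independent signals of
[sum_(d <= D) e_d], where [e_d] is the elementary symmetric polynomial of the
overlaps of the coordinates ([CAdv_sqr]).

The prior mean of a family of square-integrable functions is never formed, as
nothing makes the likelihood ratio jointly measurable in signal and observation.
Instead, a bounded measurable kernel whose sums over all finite samples are
nonnegative has a nonnegative mean ([psd_mean_ge0]); for Gram kernels corrected
by a rank-one term the hypothesis is Bessel's inequality, and the conclusion is
one of the two bounds on the advantage.

It remains to compare [e_d] with [u ^ d / d!], where [u] is the Fisher
information times the inner product of the two signals. The overlap is symmetric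
and vanishes on the axes, and the assumption on its third derivative makes its
error against [F a b] of size [|a b| (a ^ 2 + b ^ 2)] ([bilinear_expansion]).
After dilution by [k], the bound on the fourth powers of the signal shows that
the first power sum of the overlaps is within [th] of [u] and the [m]-th one is
at most [th ^ m], with [th] of order [1 / sqrt k] ([diluted_psum1],
[diluted_psum]). Newton's identities then bound [e_d - u ^ d / d!] by lower
powers of [|u|] ([elem_sym_exp_major]). Odd powers of [|u|] are absorbed by the
neighbouring even ones, and the moments of [u] are nonnegative, so the total
error is a fraction of the universal advantage once [th] is small
([elem_sym_exp_sum]).

When [k] is too small for this, [D ^ 2 <= k] bounds [D]; the [d]-th terms on both
sides are then multiplied by [lam ^ d], which replaces [th] by [lam * th] and
costs at most the constant factor [lam ^ D], because all the terms
have nonnegative means ([weighted_comparison]). *)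

Import Order.TTheory GRing.Theory Num.Theory.
Import numFieldNormedType.Exports.
Local Open Scope classical_set_scope.
Local Open Scope ring_scope.

(** * Elementary symmetric polynomials against the exponential *)

Section elementary_symmetric.
Context (R : comNzRingType) (I : finType).
Implicit Types (r : I -> R) (T : {set I}).

Definition elem_sym r (d : nat) : R :=
  \sum_(T : {set I} | #|T| == d) \prod_(i in T) r i.

Definition psum r (m : nat) : R := \sum_i r i ^+ m.

(** The monomial symmetric polynomials with one exponent [m] and [d] exponents 1,
between which the products [psum r m * elem_sym r d] telescope; for [m = 1] each
squarefree monomial is counted [d + 1] times. *)
Let mixed r (d m : nat) : R :=
  \sum_j \sum_(T : {set I} | (#|T| == d) && (j \notin T))
    r j ^+ m * \prod_(i in T) r i.

Lemma elem_sym0 r : elem_sym r 0 = 1.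
Proof.
rewrite /elem_sym (big_pred1 finset.set0) ?big_set0//.
by move=> T; rewrite cards_eq0.
Qed.

Lemma sum_elem_sym r D : \sum_(d < D.+1) elem_sym r d =
  \sum_(T : {set I} | (#|T| <= D)%N) \prod_(i in T) r i.
Proof.
rewrite /elem_sym (partition_big (fun T : {set I} => inord #|T| : 'I_D.+1) xpredT)//=.
apply: eq_bigr => d _; apply: eq_bigl => T.
apply/eqP/andP => [cT|[TD /eqP <-]]; last by rewrite inordK.
rewrite cT -ltnS ltn_ord -[X in inord X]cT cT; split => //.
by apply/eqP/val_inj; rewrite /= inordK.
Qed.

Let elem_sym_remove r d j :
  \sum_(T : {set I} | (#|T| == d.+1) && (j \in T)) \prod_(i in T) r i =
  \sum_(T : {set I} | (#|T| == d) && (j \notin T)) r j * \prod_(i in T) r i.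
Proof.
rewrite (reindex_onto (fun T => j |: T) (fun T => T :\ j)) /=; last first.
  by move=> T /andP[_ jT]; rewrite finset.setD1K.
apply: eq_big => [T|T].
  rewrite finset.setU11 andbT; have [jT|jT] := boolP (j \in T).
    rewrite andbF; apply/negbTE; rewrite negb_and; apply/orP; right.
    apply/eqP => /setP/(_ j); rewrite !inE eqxx jT//.
  by rewrite cardsU1 jT add1n eqSS finset.setU1K// eqxx.
move=> /andP[_ /eqP TE].
have jT : j \notin T by rewrite -TE finset.setD11.
by rewrite big_setU1.
Qed.

Let mixedS r d m : psum r m * elem_sym r d.+1 = mixed r d.+1 m + mixed r d m.+1.
Proof.
rewrite /psum /mixed mulr_suml -big_split/=; apply: eq_bigr => j _.
rewrite /elem_sym (bigID (fun T : {set I} => j \in T))/= mulrDr [LHS]addrC.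
congr (_ + _).
  by rewrite mulr_sumr.
rewrite elem_sym_remove mulr_sumr; apply: eq_bigr => T _.
by rewrite exprSr mulrA.
Qed.

Let mixed1 r d : mixed r d 1 = d.+1%:R * elem_sym r d.+1.
Proof.
rewrite /mixed.
under eq_bigr => j _ do under eq_bigr => T _ do rewrite expr1.
under eq_bigr => j _ do rewrite -elem_sym_remove big_mkcondr/=.
rewrite exchange_big/= /elem_sym mulr_sumr; apply: eq_bigr => T /eqP <-.
by rewrite -big_mkcond/= sumr_const mulr_natl.
Qed.

Let mixedE r d m :
  mixed r d m = \sum_(i < d.+1) (-1) ^+ i * (psum r (m + i) * elem_sym r (d - i)).
Proof.
elim: d m => [|d IH] m.
  rewrite big_ord1 expr0 mul1r addn0 elem_sym0 mulr1 /mixed /psum.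
  apply: eq_bigr => j _; rewrite (big_pred1 finset.set0) ?big_set0 ?mulr1//.
  by move=> T /=; rewrite cards_eq0; case: eqP => // ->; rewrite inE.
have -> : mixed r d.+1 m = psum r m * elem_sym r d.+1 - mixed r d m.+1.
  by rewrite mixedS addrK.
rewrite IH [RHS]big_ord_recl /= expr0 mul1r addn0 subn0 -sumrN.
congr (_ + _). apply: eq_bigr => i _.
by rewrite /bump/= add1n subSS addSnnS exprS mulN1r mulNr.
Qed.

Lemma newton_identity r d : d.+1%:R * elem_sym r d.+1 =
  \sum_(i < d.+1) (-1) ^+ i * (psum r i.+1 * elem_sym r (d - i)).
Proof. by rewrite -mixed1 mixedE. Qed.

End elementary_symmetric.

Section exponential_comparison.
Context (R : realFieldType).
Implicit Types (t th lam : R).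

Definition exp_term t (d : nat) : R := t ^+ d / d`!%:R.

Lemma exp_term0 t : exp_term t 0 = 1.
Proof. by rewrite /exp_term expr0 fact0 divr1. Qed.

Lemma exp_termS t d : d.+1%:R * exp_term t d.+1 = t * exp_term t d.
Proof.
by rewrite /exp_term factS natrM exprS invfM mulrCA mulVKf ?pnatr_eq0// mulrA.
Qed.

Lemma exp_termM a t d : exp_term (a * t) d = a ^+ d * exp_term t d.
Proof. by rewrite /exp_term exprMn mulrA. Qed.

Lemma exp_term_ge0 t d : 0 <= t -> 0 <= exp_term t d.
Proof. by move=> t0; rewrite divr_ge0// exprn_ge0. Qed.

Lemma normr_exp_term t d : `|exp_term t d| = exp_term `|t| d.
Proof. by rewrite normrM normfV normr_nat normrX. Qed.

(** The coefficients of [exp (|t| z) / (1 - th z)]. *)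
Fixpoint exp_major t th d : R :=
  exp_term `|t| d + (if d is d'.+1 then th * exp_major t th d' else 0).

Lemma exp_major_ge0 t th d : 0 <= th -> 0 <= exp_major t th d.
Proof.
move=> th0; elim: d => [|d IH] /=; first by rewrite addr0 exp_term_ge0.
by rewrite addr_ge0// ?exp_term_ge0// mulr_ge0.
Qed.

(** The coefficients of [th z / (1 - th z)] times the generating function of
[exp_major t th], which appear in its logarithmic derivative. *)
Let tail t th (d : nat) : R := \sum_(i < d) th ^+ i.+1 * exp_major t th (d - i.+1).

Let tailS t th d : tail t th d.+1 = th * (exp_major t th d + tail t th d).
Proof.
rewrite /tail big_ord_recl expr1 subn1 mulrDr; congr (_ + _).
by rewrite mulr_sumr; apply: eq_bigr => i _; rewrite exprS mulrA.
Qed.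

Let exp_majorS t th d :
  d.+1%:R * exp_major t th d.+1 = `|t| * exp_major t th d + tail t th d.+1.
Proof.
rewrite tailS; elim: d => [|d IH].
  rewrite /tail big_ord0 /= !addr0 mulrDr exp_termS exp_term0.
  by rewrite mulr1 mul1r.
have E : exp_major t th d.+2 = exp_term `|t| d.+2 + th * exp_major t th d.+1 by [].
rewrite E mulrDr exp_termS [d.+2%:R * _]mulrCA -[d.+2]addn1 natrD mulrDl mul1r.
rewrite IH tailS /=.
ring.
Qed.

(** Newton's identity reads [(d + 1) e_(d + 1) = t e_d + ...] up to terms that
involve [psum r 1 - t] and the higher power sums. Bounding these by powers of [th]
gives exactly the recursion of the majorant, so both inequalities follow by
induction. *)
Lemma elem_sym_exp_major (I : finType) (r : I -> R) t th : 0 <= th ->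
  `|psum r 1 - t| <= th ->
  (forall m, (2 <= m)%N -> `|psum r m| <= th ^+ m) ->
  forall d, `|elem_sym r d| <= exp_major t th d /\
            `|elem_sym r d - exp_term t d| <= exp_major t th d - exp_term `|t| d.
Proof.
move=> th0 p1 pm; elim/ltn_ind => -[_|d IH].
  rewrite elem_sym0 /= !exp_term0 !addr0 normr1 !subrr normr0; split.
    by apply: lexx.
  by apply: lexx.
suff H : `|elem_sym r d.+1 - exp_term t d.+1| <=
         exp_major t th d.+1 - exp_term `|t| d.+1.
  split => //; have := ler_normD (elem_sym r d.+1 - exp_term t d.+1) (exp_term t d.+1).
  rewrite subrK normr_exp_term => /le_trans; apply.
  by rewrite -lerBrDr.
have d0 : 0 < d.+1%:R :> R by rewrite ltr0n.
rewrite -(ler_pM2l d0) -[X in X * `|_|](ger0_norm (ltW d0)) -normrM !mulrBr.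
rewrite !exp_termS exp_majorS newton_identity big_ord_recl /= expr0 mul1r subn0.
have -> : tail t th d.+1 = th * exp_major t th d +
    \sum_(i < d) th ^+ i.+2 * exp_major t th (d - i.+1).
  by rewrite /tail big_ord_recl /= subn1 expr1.
set s1 := \sum_(i < d) _; set s2 := \sum_(i < d) _.
have -> : psum r 1 * elem_sym r d + s1 - t * exp_term t d =
   t * (elem_sym r d - exp_term t d) + ((psum r 1 - t) * elem_sym r d + s1) by ring.
have -> : `|t| * exp_major t th d + (th * exp_major t th d + s2) -
    `|t| * exp_term `|t| d = `|t| * (exp_major t th d - exp_term `|t| d) +
    (th * exp_major t th d + s2) by ring.
have [IH1 IH2] := IH d (ltnSn d).
apply: (le_trans (ler_normD _ _)); apply: lerD.
  by rewrite normrM ler_wpM2l.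
apply: (le_trans (ler_normD _ _)); apply: lerD.
  by rewrite normrM ler_pM.
rewrite /s1 /s2; apply: (le_trans (ler_norm_sum _ _ _)); apply: ler_sum => i _.
rewrite !normrM normrX normrN1 expr1n mul1r /bump/= add1n.
apply: ler_pM => //; first exact: pm.
by apply IH; rewrite ltnS leq_subr.
Qed.

Let exp_term_amgm (x : R) d : 0 <= x ->
  exp_term x d.+1 <= exp_term x d + exp_term x d.+2.
Proof.
move=> x0; have a0 := exp_term_ge0 d x0.
have d1 : 0 < d.+1%:R :> R by rewrite ltr0n.
have d2 : 0 < d.+2%:R :> R by rewrite ltr0n.
rewrite -(ler_pM2l d2) -(ler_pM2l d1) !mulrDr exp_termS.
rewrite [d.+1%:R * (x * _)]mulrCA exp_termS.
rewrite [d.+1%:R * (_ * exp_term x d.+1)]mulrCA exp_termS.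
have E : d.+2%:R = d.+1%:R + 1 :> R by rewrite -[d.+2]addn1 natrD.
rewrite E; have : 1 <= d.+1%:R :> R by rewrite ler1n.
set n := d.+1%:R => n1; set a := exp_term x d in a0 *.
have -> : n * ((n + 1) * a) + x * (x * a) = (n * (n + 1) + x * x) * a by ring.
rewrite mulrA ler_wpM2r//; nra.
Qed.

(** Each odd term is at most the sum of its two even neighbours, and each even term
serves two odd ones; the parity of [D] decides whether the last even term has
been used once or twice. *)
Lemma exp_sum_le_even (x : R) D : 0 <= x ->
  \sum_(d < D) exp_term x d <= 3 * \sum_(d < D.+1 | ~~ odd d) exp_term x d.
Proof.
move=> x0; have a0 d := exp_term_ge0 d x0.
suff : if odd D then
    \sum_(d < D) exp_term x d + exp_term x D.-1 <=
      3 * \sum_(d < D.+1 | ~~ odd d) exp_term x d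
  else \sum_(d < D) exp_term x d + 2 * exp_term x D <=
      3 * \sum_(d < D.+1 | ~~ odd d) exp_term x d.
  case: ifP => _; apply: le_trans; rewrite lerDl//.
  by rewrite mulr_ge0.
elim: D => [|D]; first by rewrite /= big_ord0 big_mkcond big_ord1/= exp_term0; lra.
rewrite [in X in _ -> X]big_ord_recr /=.
rewrite [\sum_(d < D.+2 | _) _]big_mkcond big_ord_recr/= -big_mkcond/=.
case: ifP => oD /=; last by rewrite addr0; lra.
case: D oD => // D oD.
have := exp_term_amgm D x0; rewrite -[D.+1.-1]/D; lra.
Qed.

(** With [q = lam * th], the left side [Z] satisfies [Z <= q (Z + Y)] for the damped
exponential sum [Y] of degree less than [D], and [Y] is controlled by the even
terms of degree at most [D]. *)
Lemma exp_major_sum t th lam D : 0 <= th -> 0 <= lam -> lam * th <= 12^-1 ->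
  \sum_(d < D.+1) lam ^+ d * (exp_major t th d - exp_term `|t| d) <=
  2^-1 * \sum_(d < D.+1 | ~~ odd d) lam ^+ d * exp_term t d.
Proof.
move=> th0 lam0 lamth.
set Y := fun D => \sum_(d < D) exp_term (lam * `|t|) d.
set Z := fun D => \sum_(d < D) lam ^+ d * (exp_major t th d - exp_term `|t| d).
have Z1 n : Z n.+1 = lam * th * (Z n + Y n).
  rewrite /Z /Y big_ord_recl /= addr0 subrr mulr0 add0r -big_split mulr_sumr/=.
  apply: eq_bigr => i _; rewrite exp_termM /bump/= add1n exprS.
  ring.
have Z0 n : 0 <= lam ^+ n * (exp_major t th n - exp_term `|t| n).
  rewrite mulr_ge0 ?exprn_ge0//; case: n => [|n] /=; first by rewrite addr0 subrr.
  by rewrite addrAC subrr add0r mulr_ge0// exp_major_ge0.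
have ZS n : Z n <= Z n.+1 by rewrite /Z big_ord_recr/= lerDl.
have YD : Y D <= 3 * \sum_(d < D.+1 | ~~ odd d) lam ^+ d * exp_term t d.
  have E : \sum_(d < D.+1 | ~~ odd d) lam ^+ d * exp_term t d =
      \sum_(d < D.+1 | ~~ odd d) exp_term (lam * `|t|) d.
    apply: eq_bigr => d od; rewrite exp_termM; congr (_ * _).
    rewrite /exp_term; congr (_ / _).
    by rewrite -normrX ger0_norm// exprn_even_ge0.
  by rewrite E; apply: exp_sum_le_even; rewrite mulr_ge0.
have Y0 : 0 <= Y D.
  by apply: sumr_ge0 => d _; rewrite exp_term_ge0// mulr_ge0.
have ZD : 0 <= Z D by apply: sumr_ge0 => d _; exact: Z0.
have := ZS D; rewrite -/(Z D.+1) Z1 => ZS'.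
have : lam * th * (Z D + Y D) <= 12^-1 * (Z D + Y D).
  by rewrite ler_wpM2r// addr_ge0.
lra.
Qed.

(** Only even powers remain in the error, so that it is a fraction of the main sum
as soon as the odd terms have nonnegative mean. *)
Lemma elem_sym_exp_sum (I : finType) (r : I -> R) t th lam D :
  0 <= th -> 0 <= lam -> lam * th <= 12^-1 ->
  `|psum r 1 - t| <= th ->
  (forall m, (2 <= m)%N -> `|psum r m| <= th ^+ m) ->
  `|\sum_(d < D.+1) lam ^+ d * elem_sym r d - \sum_(d < D.+1) lam ^+ d * exp_term t d|
  <= 2^-1 * \sum_(d < D.+1 | ~~ odd d) lam ^+ d * exp_term t d.
Proof.
move=> th0 lam0 lamth p1 pm.
apply: le_trans (exp_major_sum t D th0 lam0 lamth).
rewrite -sumrB; apply: (le_trans (ler_norm_sum _ _ _)); apply: ler_sum => d _.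
rewrite -mulrBr normrM ger0_norm ?exprn_ge0// ler_wpM2l ?exprn_ge0//.
by apply elem_sym_exp_major.
Qed.

End exponential_comparison.

(** * Second-order expansion of the channel overlap *)

Section overlap_expansion.
Context (R : realType).
Implicit Types (f : R -> R -> R) (g : R -> R) (A : R) (U : set (R * R)).

Let mean_value g x y : x <= y ->
  (forall z, x <= z <= y -> derivable g z 1) ->
  exists2 c, x <= c <= y & g y - g x = derive1 g c * (y - x).
Proof.
move=> xy dg.
have dg' z : z \in `]x, y[ -> is_derive z 1 g (derive1 g z).
  rewrite in_itv/= => /andP[xz zy]; rewrite derive1E; apply/derivableP/dg.
  by rewrite !ltW.
have cg : {within `[x, y], continuous g}.
  by apply: derivable_within_continuous => z; rewrite in_itv/= => /dg.
by have [c] := MVT_segment xy dg' cg; rewrite in_itv/=; exists c.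
Qed.

Let mean_value0 g A x : `|x| <= A -> (forall z, `|z| <= A -> derivable g z 1) ->
  exists2 c, `|c| <= `|x| & g x - g 0 = derive1 g c * x.
Proof.
move=> xA dg; have [x0|x0] := leP 0 x.
  have [z|c /andP[c0 cx] E] := @mean_value g 0 x x0.
    move=> /andP[z0 zx]; apply: dg; rewrite ger0_norm//.
    by rewrite (le_trans zx)// (le_trans _ xA)// ler_norm.
  by exists c; [rewrite !ger0_norm|rewrite E subr0].
have [z|c /andP[xc c0] E] := @mean_value g x 0 (ltW x0).
  move=> /andP[xz z0]; apply: dg; rewrite ler0_norm//.
  by rewrite (le_trans _ xA)// ltr0_norm// lerN2.
exists c; first by rewrite !ler0_norm// ?lerN2// ltW.
by rewrite -[LHS]opprB E sub0r mulrN opprK.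
Qed.

Let mean_value1 f A x b : `|x| <= A ->
  (forall z, `|z| <= A -> derivable (f^~ b) z 1) ->
  exists2 c, `|c| <= `|x| & f x b - f 0 b = pd1 f c b * x.
Proof. exact: mean_value0. Qed.

Let mean_value2 f A a x : `|x| <= A ->
  (forall z, `|z| <= A -> derivable (f a) z 1) ->
  exists2 c, `|c| <= `|x| & f a x - f a 0 = pd2 f a c * x.
Proof. exact: mean_value0. Qed.

Let pd1E f a b : pd1 f a b = derive1 (f^~ b) a. Proof. by []. Qed.

Let pd2E f a b : pd2 f a b = derive1 (f a) b. Proof. by []. Qed.

(* Derivatives are abstract from here on: only differentiation rules and the
   mean value theorem are used. *)
Opaque pd1 pd2.

Lemma bounded_on_square (h : R * R -> R) A U :
  `[- A, A] `*` `[- A, A] `<=` U ->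
  (forall p, U p -> {for p, continuous h}) ->
  exists2 M, 0 <= M & forall a b, `|a| <= A -> `|b| <= A -> `|h (a, b)| <= M.
Proof.
move=> sU ch.
have cK : compact (h @` (`[- A, A] `*` `[- A, A])).
  apply: continuous_compact; last first.
    by apply: compact_setX; exact: segment_compact.
  apply: continuous_in_subspaceT => p /set_mem /sU; exact: ch.
have [M [Mreal HM]] := compact_bounded cK.
have M1 : M < `|M| + 1 by rewrite (le_lt_trans (ler_norm M))// ltrDl.
exists (`|M| + 1); first by rewrite addr_ge0.
move=> a b aA bA; apply: (HM _ M1); exists (a, b) => //.
by split; rewrite /= in_itv/= -ler_norml.
Qed.

Lemma square_sub U A : `[- A, A] `*` `[- A, A] `<=` U ->
  forall a b, `|a| <= A -> `|b| <= A -> U (a, b).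
Proof.
by move=> sU a b aA bA; apply: sU; split; rewrite /= in_itv/= -ler_norml.
Qed.

(** For symmetric [f], the second differences over a square with corner [(a, b)] and
over the reflected square agree. Both are values of the mixed derivative at
intermediate points, times the area; let the side tend to 0. *)
Lemma pd_symmetric f U A : open U -> `[- A, A] `*` `[- A, A] `<=` U ->
  Ck 2 U f -> (forall a b, f a b = f b a) ->
  forall a b, `|a| <= A -> `|b| <= A -> pd1 (pd2 f) a b = pd1 (pd2 f) b a.
Proof.
move=> oU sU [_ [df _ [_ [dG cH _]]]] fC a b aA bA.
have Uab := square_sub sU aA bA; have Uba := square_sub sU bA aA.
case: cH => cH _.
apply/eqP; rewrite -subr_eq0 -normr_le0; apply/ler_addgt0Pr => e e0; rewrite add0r.
have e2 : 0 < e / 2 by rewrite divr_gt0.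
have near1 p : U p -> exists2 r, 0 < r & forall q, `|p.1 - q.1| < r ->
    `|p.2 - q.2| < r -> U q /\ `|pd1 (pd2 f) p.1 p.2 - pd1 (pd2 f) q.1 q.2| <= e / 2.
  move=> Up; have /cvgrPdist_le/(_ _ e2) N1 := cH _ Up.
  have N2 : nbhs p U by exact: open_nbhs_nbhs.
  have [r /= r0 rP] := (nbhs_ballP _ _).1 (filterI N2 N1).
  by exists r => // q q1 q2; apply: rP; split.
have [r1 r10 H1] := near1 _ Uab; have [r2 r20 H2] := near1 _ Uba.
pose s := Num.min r1 r2 / 2.
have s0 : 0 < s by rewrite divr_gt0// lt_min r10.
have sr : s < Num.min r1 r2 by rewrite ltr_pdivrMr// ltr_pMr ?lt_min ?r10// ltr1n.
have {sr} [s1 s2] : s < r1 /\ s < r2 by move: sr; rewrite lt_min => /andP.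
have close (x y r : R) : s < r -> x <= y <= x + s -> `|x - y| < r.
  move=> sr /andP[xy ys]; rewrite distrC ger0_norm ?subr_ge0//.
  by rewrite (le_lt_trans _ sr)// lerBlDl.
(* Two applications of the mean value theorem to the second difference of [f]
   over a square of side [s] with corner [(x, y)]. *)
have second (x y r : R) : s < r ->
    (forall q, `|x - q.1| < r -> `|y - q.2| < r -> U q) ->
    exists p q, [/\ x <= p <= x + s, y <= q <= y + s &
      f (x + s) (y + s) - f x (y + s) - (f (x + s) y - f x y) =
      pd1 (pd2 f) p q * s * s].
  move=> sr Ur; have xs : x <= x + s by rewrite lerDl ltW.
  have ys : y <= y + s by rewrite lerDl ltW.
  have dfy z : y <= z <= y + s -> derivable (f (x + s)) z 1 /\ derivable (f x) z 1.
    move=> zy; have yz := close _ _ _ sr zy; split.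
      apply: (df (x + s, z) _).2; apply: Ur => //=.
      by apply: close => //; rewrite xs lexx.
    by apply: (df (x, z) _).2; apply: Ur => //=; rewrite subrr normr0 (lt_trans s0).
  have [z /dfy[d1 d2]|q qy Eq] := @mean_value (f (x + s) - f x) _ _ ys.
    exact: derivableB.
  have [d1 d2] := dfy _ qy.
  have Dq : derive1 (f (x + s) - f x) q = pd2 f (x + s) q - pd2 f x q.
    by rewrite derive1E (deriveB d1 d2) !pd2E !derive1E.
  have [z zx|p px Ep] := @mean_value (fun z => pd2 f z q) _ _ xs.
    apply: (dG (z, q) _).1; apply: Ur => /=; exact: close.
  exists p, q; split => //.
  have xs' : x + s - x = s by rewrite addrAC subrr add0r.
  have ys' : y + s - y = s by rewrite addrAC subrr add0r.
  by move: Eq; rewrite ys' Dq Ep xs' pd1E.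
have [|p [q [px qy E1]]] := second a b r1 s1.
  by move=> q q1 q2; apply H1.
have [|p' [q' [px' qy' E2]]] := second b a r2 s2.
  by move=> q' q1 q2; apply H2.
have E : pd1 (pd2 f) p q = pd1 (pd2 f) p' q'.
  move: (pd1 (pd2 f) p q) (pd1 (pd2 f) p' q') E1 E2 => h h' E1 E2.
  apply: (mulIf (lt0r_neq0 s0)); apply: (mulIf (lt0r_neq0 s0)).
  rewrite -E1 -E2 [f (b + s) (a + s)]fC [f b (a + s)]fC [f (b + s) a]fC [f b a]fC.
  ring.
have [||_ B1] := H1 (p, q); [exact: close..|].
have [||_ B2] := H2 (p', q'); [exact: close..|].
rewrite /= E in B1; rewrite /= in B2.
move: (pd1 (pd2 f) a b) (pd1 (pd2 f) b a) (pd1 (pd2 f) p' q') B1 B2 => u v w B1 B2.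
clear -B1 B2.
by rewrite (le_trans (ler_distD w _ _))// [leRHS](splitr e) lerD// distrC.
Qed.

(** Along the first axis [H] is controlled by its second derivatives, as its first
derivative vanishes at the origin; the symmetry of [H] gives the other axis. *)
Let stationary_bound H U A : 0 < A -> `[- A, A] `*` `[- A, A] `<=` U ->
  (forall p, U p -> derivable (H^~ p.2) p.1 1 /\ derivable (H p.1) p.2 1) ->
  Ck 1 U (pd1 H) -> pd1 H 0 0 = 0 ->
  (forall b, `|b| <= A -> H 0 b = H b 0) ->
  exists2 C, 0 <= C & forall a b, `|a| <= A -> `|b| <= A ->
    `|H a b - H 0 0| <= C * (a ^+ 2 + b ^+ 2).
Proof.
move=> A0 sU dH [_ [dK [cK1 _] [cK2 _]]] K0 Hsym.
have sq := square_sub sU.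
have A00 : `|0 : R| <= A by rewrite normr0 ltW.
have [M1 M10 HM1] := bounded_on_square sU cK1.
have [M2 M20 HM2] := bounded_on_square sU cK2.
rewrite /= in HM1 HM2.
have Kbound a b : `|a| <= A -> `|b| <= A -> `|pd1 H a b| <= M1 * `|a| + M2 * `|b|.
  move=> aA bA.
  have [z zA|p pa Ep] := @mean_value1 (pd1 H) A a b aA.
    by apply: (dK (z, b) _).1; exact: sq.
  have [z zA|q qb Eq] := @mean_value2 (pd1 H) A 0 b bA.
    by apply: (dK (0, z) _).2; exact: sq.
  have HMp := HM1 p b (le_trans pa aA) bA.
  have HMq := HM2 0 q A00 (le_trans qb bA).
  rewrite K0 subr0 in Eq.
  move: Ep HMp; rewrite {}Eq => /eqP; rewrite subr_eq => /eqP ->.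
  move: (pd1 (pd1 H) p b) (pd2 (pd1 H) 0 q) HMq => u v vM uM.
  rewrite (le_trans (ler_normD _ _))// !normrM.
  by apply: lerD; apply: ler_wpM2r.
have Hbound a b : `|a| <= A -> `|b| <= A ->
    `|H a b - H 0 b| <= (M1 * `|a| + M2 * `|b|) * `|a|.
  move=> aA bA.
  have [z zA|p pa ->] := @mean_value1 H A a b aA.
    by apply: (dH (z, b) _).1; exact: sq.
  rewrite normrM ler_wpM2r//.
  apply: (le_trans (Kbound _ _ (le_trans pa aA) bA)).
  by rewrite lerD2r ler_wpM2l.
exists (M1 + M2); first by rewrite addr_ge0.
move=> a b aA bA.
apply: (le_trans (ler_distD (H 0 b) _ _)); rewrite (Hsym b bA).
have := Hbound _ _ bA A00; have := Hbound _ _ aA bA.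
rewrite (Hsym b bA) normr0 mulr0 addr0.
move: (H a b) (H b 0) (H 0 0) => u v w; clear -M10 M20.
move=> uv vw; apply: (le_trans (lerD uv vw)).
rewrite -[a ^+ 2]real_normK ?num_real// -[b ^+ 2]real_normK ?num_real//.
have : 0 <= M2 * (`|a| - `|b|) ^+ 2 by rewrite mulr_ge0 ?sqr_ge0.
have : 0 <= M2 * `|a| ^+ 2 by rewrite mulr_ge0 ?sqr_ge0.
have : 0 <= M2 * `|b| ^+ 2 by rewrite mulr_ge0 ?sqr_ge0.
rewrite !expr2; nra.
Qed.

(** Since [f] vanishes on the axes, [f a b = a b H] with the mixed derivative
[H] taken at an intermediate point; [H] is symmetric and stationary at the
origin, so it moves by second order only. *)
Lemma bilinear_expansion f U A : 0 < A ->
  open U -> `[- A, A] `*` `[- A, A] `<=` U ->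
  Ck 4 U f -> (forall a b, f a b = f b a) -> (forall b, f 0 b = 0) ->
  pd1 (pd1 (pd2 f)) 0 0 = 0 ->
  exists2 C, 0 <= C & forall a b, `|a| <= A -> `|b| <= A ->
    `|f a b - pd1 (pd2 f) 0 0 * (a * b)| <= C * (`|a * b| * (a ^+ 2 + b ^+ 2)).
Proof.
move=> A0 oU sU Cf fC f0 C2.
have C2f : Ck 2 U f.
  move: Cf => [cf [df [c1 [d1 [c11 _] [c12 _]]] [c2 [d2 [c21 _] [c22 _]]]]].
  by split => //; split => //; split => //; split => //.
have A00 : `|0 : R| <= A by rewrite normr0 ltW.
have Hsym b (bA : `|b| <= A) := pd_symmetric oU sU C2f fC A00 bA.
have sq := square_sub sU.
move: Cf => [_ [df _ [_ [dG [_ [dH cK _]] _]]]].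
have [C C0 HC] := stationary_bound A0 sU dH cK C2 Hsym.
exists C => // a b aA bA.
have [z zA|q qb Eq] := @mean_value2 f A a b bA.
  by apply: (df (a, z) _).2; exact: sq.
have [z zA|p pa Ep] := @mean_value1 (pd2 f) A a q aA.
  by apply: (dG (z, q) _).1; apply: sq => //; exact: le_trans bA.
have G0 : pd2 f 0 q = 0.
  have f00 : f 0 = cst 0 by apply/funext => z; exact: f0.
  by rewrite pd2E f00 derive1_cst.
have := HC p q (le_trans pa aA) (le_trans qb bA).
rewrite (fC a 0) f0 subr0 in Eq; rewrite G0 subr0 in Ep; rewrite {}Eq {}Ep.
move: (pd1 (pd2 f) p q) (pd1 (pd2 f) 0 0) => u v; clear -C0 pa qb => uv.
rewrite -mulrA -mulrBl normrM mulrC mulrCA ler_wpM2l//.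
apply: (le_trans uv); rewrite ler_wpM2l// lerD//.
  by rewrite -[leLHS]real_normK ?num_real// -[leRHS]real_normK ?num_real// ler_pXn2r ?nnegrE.
by rewrite -[leLHS]real_normK ?num_real// -[leRHS]real_normK ?num_real// ler_pXn2r ?nnegrE.
Qed.

Transparent pd1 pd2.
End overlap_expansion.

(** * Means of positive kernels *)

Section bounded_measurable.
Context d (T : measurableType d) (R : realType).
Implicit Types (f g : T -> R).

Definition bmeas f : Prop :=
  measurable_fun setT f /\ exists M, forall x, `|f x| <= M.

Lemma bmeas_cst c : bmeas (fun=> c).
Proof. by split => //; exists `|c|. Qed.

Lemma bmeasD f g : bmeas f -> bmeas g -> bmeas (fun x => f x + g x).
Proof.
move=> [mf [M fM]] [mg [N gN]]; split; first exact: measurable_funD.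
by exists (M + N) => x; rewrite (le_trans (ler_normD _ _))// lerD.
Qed.

Lemma bmeasM f g : bmeas f -> bmeas g -> bmeas (fun x => f x * g x).
Proof.
move=> [mf [M fM]] [mg [N gN]]; split; first exact: measurable_funM.
by exists (M * N) => x; rewrite normrM ler_pM.
Qed.

Lemma bmeasZ c f : bmeas f -> bmeas (fun x => c * f x).
Proof. by move=> bf; apply: bmeasM => //; exact: bmeas_cst. Qed.

Lemma bmeasB f g : bmeas f -> bmeas g -> bmeas (fun x => f x - g x).
Proof.
move=> bf bg; rewrite (_ : (fun _ => _) = fun x => f x + (-1) * g x).
  by apply: bmeasD => //; exact: bmeasZ.
by apply/funext => x; rewrite mulN1r.
Qed.

Lemma bmeas_norm f : bmeas f -> bmeas (fun x => `|f x|).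
Proof.
move=> [mf [M fM]]; split; first exact: measurableT_comp.
by exists M => x; rewrite normr_id.
Qed.

Lemma bmeasX f n : bmeas f -> bmeas (fun x => f x ^+ n).
Proof.
move=> bf; elim: n => [|n IH].
  by under eq_fun do rewrite expr0; exact: bmeas_cst.
by under eq_fun do rewrite exprS; exact: bmeasM.
Qed.

Lemma bmeas_sum (I : Type) (s : seq I) (P : pred I) (h : I -> T -> R) :
  (forall i, P i -> bmeas (h i)) -> bmeas (fun x => \sum_(i <- s | P i) h i x).
Proof.
move=> bh; elim: s => [|i s IH].
  by under eq_fun do rewrite big_nil; exact: bmeas_cst.
under eq_fun do rewrite big_cons.
by have [Pi|_] := boolP (P i) => //; apply: bmeasD => //; exact: bh.
Qed.

Lemma bmeas_prod (I : Type) (s : seq I) (P : pred I) (h : I -> T -> R) :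
  (forall i, P i -> bmeas (h i)) -> bmeas (fun x => \prod_(i <- s | P i) h i x).
Proof.
move=> bh; elim: s => [|i s IH].
  by under eq_fun do rewrite big_nil; exact: bmeas_cst.
under eq_fun do rewrite big_cons.
by have [Pi|_] := boolP (P i) => //; apply: bmeasM => //; exact: bh.
Qed.

Variable X : probability T R.

Lemma bmeas_integrable f : bmeas f -> X.-integrable setT (EFin \o f).
Proof.
move=> [mf [M fM]]; apply: measurable_bounded_integrable => //.
  exact: le_lt_trans (probability_le1 X measurableT) (ltry 1).
exists M; split; first by rewrite num_real.
by move=> N MN x _ /=; apply: (le_trans (fM x)); exact: ltW.
Qed.

Lemma EFin_Rintegral f : X.-integrable setT (EFin \o f) ->
  (\int[X]_x (f x)%:E)%E = (\int[X]_x f x)%:E.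
Proof. by move=> bf; rewrite /Rintegral fineK//; exact: integrable_fin_num. Qed.

Lemma mean_cst c : \int[X]_x (fun=> c) x = c.
Proof.
rewrite Rintegral_cst// -[RHS]mulr1; congr (_ * _).
exact: (congr1 fine (probability_setT X)).
Qed.

Lemma meanD f g : bmeas f -> bmeas g ->
  \int[X]_x (f x + g x) = \int[X]_x f x + \int[X]_x g x.
Proof. by move=> bf bg; rewrite RintegralD//; exact: bmeas_integrable. Qed.

Lemma meanB f g : bmeas f -> bmeas g ->
  \int[X]_x (f x - g x) = \int[X]_x f x - \int[X]_x g x.
Proof. by move=> bf bg; rewrite RintegralB//; exact: bmeas_integrable. Qed.

Lemma meanZ c f : bmeas f -> \int[X]_x (c * f x) = c * \int[X]_x f x.
Proof. by move=> bf; rewrite RintegralZl//; exact: bmeas_integrable. Qed.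

Lemma mean_sum (I : Type) (s : seq I) (P : pred I) (h : I -> T -> R) :
  (forall i, P i -> bmeas (h i)) ->
  \int[X]_x (\sum_(i <- s | P i) h i x) = \sum_(i <- s | P i) \int[X]_x h i x.
Proof.
move=> bh; elim: s => [|i s IH].
  by under eq_Rintegral do rewrite big_nil; rewrite mean_cst big_nil.
under eq_Rintegral do rewrite big_cons; rewrite big_cons -IH.
by case: ifP => // Pi; rewrite meanD//; [exact: bh|exact: bmeas_sum].
Qed.

Lemma mean_le f g : bmeas f -> bmeas g -> (forall x, f x <= g x) ->
  \int[X]_x f x <= \int[X]_x g x.
Proof. by move=> bf bg fg; apply: le_Rintegral => //; exact: bmeas_integrable. Qed.

Lemma mean_ge0 f : (forall x, 0 <= f x) -> 0 <= \int[X]_x f x.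
Proof. by move=> f0; apply: Rintegral_ge0. Qed.

Lemma mean_norm_le f M : bmeas f -> (forall x, `|f x| <= M) -> `|\int[X]_x f x| <= M.
Proof.
move=> bf fM; apply: (le_trans (le_normr_Rintegral _ _)) => //.
  exact: bmeas_integrable.
rewrite -[leRHS]mean_cst; apply: mean_le => //; last exact: bmeas_cst.
exact: bmeas_norm.
Qed.

End bounded_measurable.

Lemma bmeas_comp d d' (T : measurableType d) (T' : measurableType d') (R : realType)
    (h : T' -> T) (f : T -> R) :
  measurable_fun setT h -> bmeas f -> bmeas (f \o h).
Proof.
move=> mh [mf [M fM]]; split; first exact: measurableT_comp.
by exists M => x /=.
Qed.

Section kernels.
Context d (T : measurableType d) (R : realType) (X : probability T R).
Implicit Types (K : T * T -> R) (f g : T -> R).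

Lemma bmeas_section K x : bmeas K -> bmeas (fun y => K (x, y)).
Proof. exact: (bmeas_comp (pair1_measurable x)). Qed.

Lemma bmeas_fst f : bmeas f -> bmeas (fun z : T * T => f z.1).
Proof. exact: (bmeas_comp measurable_fst). Qed.

Lemma bmeas_snd f : bmeas f -> bmeas (fun z : T * T => f z.2).
Proof. exact: (bmeas_comp measurable_snd). Qed.

Lemma bmeas_partial_mean K : bmeas K -> bmeas (fun x => \int[X]_y K (x, y)).
Proof.
move=> bK; have [mK [M KM]] := bK; split; last first.
  by exists M => x; apply: mean_norm_le => //; exact: bmeas_section.
apply: measurableT_comp => //.
exact: (measurable_fubini_F (bmeas_integrable (X \x X)%E bK)).
Qed.

Lemma mean_product K : bmeas K ->
  \int[(X \x X)%E]_z K z = \int[X]_x \int[X]_y K (x, y).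
Proof.
move=> bK; have ibK := bmeas_integrable (X \x X)%E bK.
rewrite {1}/Rintegral -(integral12_prod_meas1 ibK).
congr fine; apply: eq_integral => x _.
by rewrite -EFin_Rintegral//; exact/bmeas_integrable/bmeas_section.
Qed.

Lemma mean_tensor f g : bmeas f -> bmeas g ->
  \int[(X \x X)%E]_z (f z.1 * g z.2) = (\int[X]_x f x) * (\int[X]_x g x).
Proof.
move=> bf bg; rewrite (mean_product (bmeasM (bmeas_fst bf) (bmeas_snd bg))) /=.
under eq_Rintegral => x _ do rewrite meanZ//.
under eq_Rintegral => x _ do rewrite mulrC.
by rewrite meanZ// mulrC.
Qed.

(** For [m] independent samples from [X], the diagonal contributes at most [m M] to
the expected sum, while the other pairs contribute [m (m - 1)] times the mean,
which can therefore not be negative. The samples are integrated out one at a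
time: the expression in [claim m s] is the conditional expectation of the sum
over [s] and [m] further samples, with [M] in place of the new diagonal
terms. *)
Lemma psd_mean_ge0 K : bmeas K -> (forall x y, K (x, y) = K (y, x)) ->
  (forall s : seq T, 0 <= \sum_(x <- s) \sum_(y <- s) K (x, y)) ->
  0 <= \int[(X \x X)%E]_z K z.
Proof.
move=> bK Ksym Kpos; rewrite mean_product//.
have [_ [M KM]] := bK.
pose kap x := \int[X]_y K (x, y).
have bkap : bmeas kap by exact: bmeas_partial_mean.
rewrite -/(\int[X]_x kap x); set S := \int[X]_x kap x.
have claim m : forall s : seq T, 0 <= \sum_(x <- s) \sum_(y <- s) K (x, y) +
    2 * m%:R * \sum_(x <- s) kap x + m%:R * (m%:R - 1) * S + m%:R * M.
  elim: m => [|m IH] s; first by rewrite mulr0 !mul0r !addr0.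
  set A := \sum_(x <- s) _; set B := \sum_(x <- s) kap x.
  pose c := A + M + 2 * m%:R * B + m%:R * (m%:R - 1) * S + m%:R * M.
  have step x : 0 <= c + (2 * (\sum_(y <- s) K (y, x)) + 2 * m%:R * kap x).
    have := IH (x :: s); rewrite !big_cons.
    under [X in _ + X + _ * _ + _ + _]eq_bigr => y _ do rewrite big_cons.
    rewrite big_split/= -/A -/B.
    under [X in K (x, x) + X]eq_bigr => y _ do rewrite Ksym.
    have := le_trans (ler_norm _) (KM (x, x)).
    rewrite /c; lra.
  have bs y : bmeas (fun x => K (y, x)) by exact: bmeas_section.
  have b1 : bmeas (fun x => 2 * \sum_(y <- s) K (y, x)).
    by apply: bmeasZ; apply: bmeas_sum => y _; exact: bs.
  have b2 : bmeas (fun x => 2 * m%:R * kap x) by exact: bmeasZ.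
  have : 0 <= \int[X]_x (c + (2 * (\sum_(y <- s) K (y, x)) + 2 * m%:R * kap x)).
    exact: mean_ge0.
  rewrite meanD//; [|exact: bmeas_cst|exact: bmeasD].
  rewrite mean_cst meanD// !meanZ//; last by apply: bmeas_sum => y _; exact: bs.
  rewrite mean_sum; last by move=> y _; exact: bs.
  rewrite -/B -/S /c => H.
  have -> : A + 2 * m.+1%:R * B + m.+1%:R * (m.+1%:R - 1) * S + m.+1%:R * M =
    A + M + 2 * m%:R * B + m%:R * (m%:R - 1) * S + m%:R * M +
    (2 * B + 2 * m%:R * S) by rewrite -natr1; ring.
  exact: H.
apply/ler_addgt0Pr => e e0.
have [n Hn] : exists n : nat, M / e < n%:R.
  exists (Num.bound `|M / e|).
  exact: le_lt_trans (ler_norm _) (archi_boundP (normr_ge0 _)).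
rewrite ltr_pdivrMr// in Hn.
have := claim n.+1 [::]; rewrite !big_nil mulr0 !add0r -mulrA -mulrDr.
rewrite pmulr_rge0 ?ltr0n// -natr1 addrK => H.
have M0 : 0 <= M.
  have /(_ 1%N [::]) := claim.
  by rewrite !big_nil mulr0 !add0r subrr mulr0 mul0r add0r mul1r.
have [n0|n0] := posnP n; first by rewrite n0 mul0r in Hn; lra.
have n0' : 0 < n%:R :> R by rewrite ltr0n.
rewrite -(pmulr_rge0 _ n0') mulrDr; lra.
Qed.

End kernels.

(** * Joint measurability of continuous kernels *)

Section joint_measurability.
Context d (T : measurableType d) (R : realType).
Import HBNNSimple.

(** The first argument is approximated by simple functions; continuity is then
used in each variable separately. *)
Lemma measurable_continuous2 (g : R -> R -> R) (f b : T -> R) :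
  (forall u v, g z.1 z.2 @[z --> (u, v)] --> g u v) ->
  measurable_fun setT f -> (forall x, 0 <= f x) -> measurable_fun setT b ->
  measurable_fun setT (fun x => g (f x) (b x)).
Proof.
move=> cg mf f0 mb.
have mF : measurable_fun setT (EFin \o f) by exact/measurable_EFinP.
pose s := nnsfun_approx measurableT mF.
have cs x : s n x @[n --> \oo] --> f x.
  have := @cvg_nnsfun_approx _ _ _ _ measurableT _ mF (fun x _ => f0 x) x I.
  by move=> /fine_cvgP[].
apply: (@measurable_fun_cvg _ _ _ _ (fun n x => g (s n x) (b x))); last first.
  move=> x _; apply: (@continuous2_cvg _ _ _ _ _ _ _ _ g).
  - exact: cg.
  - exact: cs.
  - exact: cvg_cst.
move=> n _ Y mY; rewrite setTI.
have mg v : measurable_fun setT (fun x => g v (b x)).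
  apply: (measurableT_comp _ mb); apply: continuous_measurable_fun => w.
  by apply: (@continuous2_cvg _ _ _ _ _ _ _ _ g); [exact: cg|exact: cvg_cst|exact: cvg_id].
rewrite (_ : _ @^-1` _ = \bigcup_(v in range (s n))
    (s n @^-1` [set v] `&` (fun x => g v (b x)) @^-1` Y)).
  apply: fin_bigcup_measurable => [|v _]; first exact: fimfunP.
  apply: measurableI; first exact: measurable_sfunP.
  by rewrite -[X in measurable X]setTI; exact: mg.
apply/seteqP; split => [x /= gY|x [v _ [/= <- //]]].
by exists (s n x) => //; exists x.
Qed.

End joint_measurability.

Section clip.
Context (R : realType) (A : R).
Hypothesis A0 : 0 <= A.

Definition clip (a : R) : R := Num.max (- A) (Num.min A a).

Lemma clip_bound a : `|clip a| <= A.
Proof. by rewrite ler_norml /clip le_max lexx ge_max ge_min lexx /= andbT ge0_cp. Qed.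

Lemma clip_id a : `|a| <= A -> clip a = a.
Proof. by rewrite ler_norml => /andP[? ?]; rewrite /clip min_r// max_r. Qed.

Lemma clip_continuous : continuous clip.
Proof.
move=> a.
have cmin : {for a, continuous ((cst A : R -> R^o) \min (idfun : R -> R^o))}.
  by apply: continuous_min; [exact: cvg_cst|exact: cvg_id].
by apply: (continuous_max (f := (cst (- A) : R -> R^o)) _ cmin); exact: cvg_cst.
Qed.

End clip.

Section square_kernel.
Context d (T : measurableType d) (R : realType).

(** A function continuous around a square is only known there, so its arguments
are truncated to the square before appealing to joint continuity. *)
Lemma bmeas_square_kernel (K : R -> R -> R) A (U : set (R * R)) (f b : T -> R) :
  0 < A -> `[- A, A] `*` `[- A, A] `<=` U ->
  (forall p, U p -> {for p, continuous (fun q : R * R => K q.1 q.2)}) ->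
  measurable_fun setT f -> (forall x, `|f x| <= A) ->
  measurable_fun setT b -> (forall x, `|b x| <= A) ->
  bmeas (fun x => K (f x) (b x)).
Proof.
move=> A0 sU cK mf fA mb bA.
have [M _ KM] := bounded_on_square sU cK.
split; last by exists M => x; exact: KM.
pose g u v := K (clip A (u - A)) (clip A v).
rewrite (_ : (fun x => _) = fun x => g (f x + A) (b x)); last first.
  by apply/funext => x; rewrite /g addrK !clip_id// ltW.
apply: measurable_continuous2 => //; last 2 first.
- exact: measurable_funD.
- move=> x; have := fA x; rewrite ler_norml => /andP[+ _].
  by rewrite lerNl -subr_ge0 opprK addrC.
move=> u v; rewrite /g.
apply: (@continuous2_cvg _ _ _ _ _ _ _ _ K).
- apply: (cK (clip A (u - A), clip A v)); apply: square_sub sU _ _ _ _.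
  + by rewrite clip_bound// ltW.
  + by rewrite clip_bound// ltW.
- apply: (@continuous_cvg _ _ _ _ _ _ (clip A)); first exact: clip_continuous.
  by apply: cvgB; [exact: cvg_fst|exact: cvg_cst].
- by apply: (@continuous_cvg _ _ _ _ _ _ (clip A)); [exact: clip_continuous|exact: cvg_snd].
Qed.

End square_kernel.

(** * Square-integrable functions *)

Section inner_product.
Context d (Y : measurableType d) (R : realType) (Q : probability Y R).
Implicit Types (f g : Y -> R).

Local Notation L2 f := (f \in Lfun Q 2%:E).

Lemma L2_measurable f : L2 f -> measurable_fun setT f.
Proof. by rewrite inE => /andP[+ _]; rewrite inE. Qed.

Lemma L2_intro f : measurable_fun setT f ->
  Q.-integrable setT (fun y => (f y ^+ 2)%:E) -> L2 f.
Proof.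
move=> mf /integrableP[_ if2]; rewrite inE; apply/andP; split; rewrite inE//=.
rewrite /finite_norm unlock poweR_lty//.
move: if2; congr (_ < _)%E; apply: eq_integral => y _ /=.
by rewrite powR_mulrn// normrX real_normK ?num_real// ger0_norm ?sqr_ge0.
Qed.

Lemma L2_cst c : L2 (fun=> c).
Proof. exact: Lfun_cst. Qed.

Lemma L2D f g : L2 f -> L2 g -> L2 (fun y => f y + g y).
Proof.
have p1 : (1 <= 2%:E :> \bar R)%E by rewrite lee_fin ler1n.
by move=> lf lg; have [_] := Lfun_addr_closed Q p1; exact.
Qed.

Lemma L2Z c f : L2 f -> L2 (fun y => c * f y).
Proof.
have p1 : (1 <= 2 :> R) by rewrite ler1n.
move=> lf; have := Lfun_scale c p1 lf.
by rewrite (_ : _ \o* _ = fun y => c * f y)//; apply/funext => y /=; rewrite mulrC.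
Qed.

Lemma L2_sum (I : Type) (s : seq I) (p : pred I) (h : I -> Y -> R) :
  (forall i, p i -> L2 (h i)) -> L2 (fun y => \sum_(i <- s | p i) h i y).
Proof.
move=> lh; elim: s => [|i s IH].
  by under eq_fun do rewrite big_nil; exact: L2_cst.
under eq_fun do rewrite big_cons.
by have [pi|//] := boolP (p i); apply: L2D => //; exact: lh.
Qed.

Definition ip f g : R := \int[Q]_y (f y * g y).

Lemma L2_integrable_mul f g : L2 f -> L2 g ->
  Q.-integrable setT (fun y => (f y * g y)%:E).
Proof. by move=> lf lg; apply/Lfun1_integrable; exact: Lfun2_mul_Lfun1. Qed.

Lemma ipC f g : ip f g = ip g f.
Proof. by apply: eq_Rintegral => y _; rewrite mulrC. Qed.

Lemma ip_ge0 f : 0 <= ip f f.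
Proof. by apply: Rintegral_ge0 => y _; rewrite -expr2 sqr_ge0. Qed.

Lemma ipDl f g h : L2 f -> L2 g -> L2 h ->
  ip (fun y => f y + g y) h = ip f h + ip g h.
Proof.
move=> lf lg lh; rewrite /ip -RintegralD//; try exact: L2_integrable_mul.
by apply: eq_Rintegral => y _; rewrite mulrDl.
Qed.

Lemma ipZl c f h : L2 f -> L2 h -> ip (fun y => c * f y) h = c * ip f h.
Proof.
move=> lf lh; rewrite /ip -RintegralZl//; last exact: L2_integrable_mul.
by apply: eq_Rintegral => y _; rewrite mulrA.
Qed.

Lemma ip_suml (I : Type) (s : seq I) (p : pred I) (F : I -> Y -> R) h :
  (forall i, p i -> L2 (F i)) -> L2 h ->
  ip (fun y => \sum_(i <- s | p i) F i y) h = \sum_(i <- s | p i) ip (F i) h.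
Proof.
move=> lF lh; elim: s => [|i s IH].
  rewrite big_nil /ip; under eq_Rintegral do rewrite big_nil mul0r.
  exact: mean_cst.
rewrite big_cons -IH /ip; under eq_Rintegral do rewrite big_cons.
case: ifPn => // pi; rewrite -/(ip _ _) ipDl//; [exact: lF|exact: L2_sum].
Qed.

Lemma ip_sumr (I : Type) (s : seq I) (p : pred I) (F : I -> Y -> R) h :
  (forall i, p i -> L2 (F i)) -> L2 h ->
  ip h (fun y => \sum_(i <- s | p i) F i y) = \sum_(i <- s | p i) ip h (F i).
Proof.
by move=> lF lh; rewrite ipC ip_suml//; apply: eq_bigr => i _; rewrite ipC.
Qed.

(** The case of a single vector [f]: expand the squared norm of [g - <f, g> f]. *)
Lemma ip_bessel f g : L2 f -> L2 g -> ip f f <= 1 -> ip f g ^+ 2 <= ip g g.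
Proof.
move=> lf lg f1; set c := ip f g.
have lcf : L2 (fun y => - c * f y) by exact: L2Z.
pose k y := g y + - c * f y.
have lk : L2 k by exact: L2D.
have Ek h : L2 h -> ip k h = ip g h + - c * ip f h.
  by move=> lh; rewrite /k ipDl// ipZl.
have := ip_ge0 k; rewrite Ek// [ip g k]ipC [ip f k]ipC !Ek// [ip g f]ipC -/c.
have := ip_ge0 f; nra.
Qed.

End inner_product.

(** * Product laws *)

Section product_laws.
Context d (T : measurableType d) (R : realType).
Local Open Scope ereal_scope.

Let behead n (mu : 'I_n.+1 -> probability T R) : probability (n.-tuple T) R :=
  prod_law (fun i => mu (lift ord0 i)).

Lemma ge0_integral_prod_lawS n (mu : 'I_n.+1 -> probability T R)
    (F : n.+1.-tuple T -> \bar R) :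
  measurable_fun setT F -> (forall y, 0 <= F y) ->
  \int[prod_law mu]_y F y =
  \int[mu ord0]_a \int[behead mu]_y F (cons_pair (a, y)).
Proof.
move=> mF F0; rewrite [LHS]ge0_integral_distribution//.
rewrite fubini_tonelli1//; last by move=> z; exact: F0.
by apply: measurableT_comp => //; exact: measurable_cons_pair.
Qed.

Lemma integrable_prod_lawS n (mu : 'I_n.+1 -> probability T R)
    (F : n.+1.-tuple T -> \bar R) :
  (prod_law mu).-integrable setT F ->
  (mu ord0 \x behead mu).-integrable setT (F \o @cons_pair _ T n).
Proof.
move=> /integrableP[mF iF]; apply/integrableP; split.
  by apply: measurableT_comp => //; exact: measurable_cons_pair.
move: iF; rewrite [X in X < _ -> _]ge0_integral_distribution//.
exact: measurableT_comp.
Qed.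

Lemma integral_prod_lawS n (mu : 'I_n.+1 -> probability T R)
    (F : n.+1.-tuple T -> \bar R) :
  (prod_law mu).-integrable setT F ->
  \int[prod_law mu]_y F y = \int[mu ord0 \x behead mu]_z F (cons_pair z).
Proof.
move=> iF; rewrite [LHS]integral_distribution//.
  exact: measurable_int iF.
exact: integrable_prod_lawS.
Qed.

Lemma measurable_prod_tnth n (a : 'I_n -> T -> R) :
  (forall i, measurable_fun setT (a i)) ->
  measurable_fun setT (fun y : n.-tuple T => \prod_(i < n) a i (tnth y i))%R.
Proof.
move=> ma; apply: measurable_prod => i _.
by apply: measurableT_comp => //; exact: measurable_tnth.
Qed.

Let tnth_cons_pair0 n (z : T * n.-tuple T) : tnth (cons_pair z) ord0 = z.1.
Proof. by []. Qed.

Let tnth_cons_pairS n (z : T * n.-tuple T) i :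
  tnth (cons_pair z) (lift ord0 i) = tnth z.2 i.
Proof. by rewrite /cons_pair tnthS. Qed.

(** The densities multiply: one coordinate is changed at a time, by Tonelli. *)
Lemma prod_law_density n (mu nu : 'I_n -> probability T R) (g : 'I_n -> T -> R) :
  (forall i, measurable_fun setT (g i)) -> (forall i a, (0 <= g i a)%R) ->
  (forall i (F : T -> \bar R), measurable_fun setT F -> (forall a, 0 <= F a) ->
    \int[mu i]_a F a = \int[nu i]_a (F a * (g i a)%:E)) ->
  forall F : n.-tuple T -> \bar R, measurable_fun setT F -> (forall y, 0 <= F y) ->
  \int[prod_law mu]_y F y =
  \int[prod_law nu]_y (F y * (\prod_(i < n) g i (tnth y i))%:E).
Proof.
elim: n mu nu g => [|n IH] mu nu g mg g0 dens F mF F0.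
  under [in RHS]eq_integral do rewrite big_ord0 mule1.
  by rewrite /= !integral_dirac.
pose G := fun y : n.-tuple T => (\prod_(i < n) g (lift ord0 i) (tnth y i))%R.
have mG : measurable_fun setT G.
  exact: (@measurable_prod_tnth n (fun i => g (lift ord0 i)) (fun i => mg _)).
have G0 y : (0 <= G y)%R by apply: prodr_ge0 => i _; exact: g0.
have mFc : measurable_fun setT (F \o @cons_pair _ T n).
  by apply: measurableT_comp => //; exact: measurable_cons_pair.
have mFG : measurable_fun setT
    (fun z : T * n.-tuple T => F (cons_pair z) * (G z.2)%:E).
  apply: emeasurable_funM => //; apply/measurable_EFinP.
  exact: measurableT_comp.
rewrite !ge0_integral_prod_lawS//; last 2 first.
- apply: emeasurable_funM => //; apply/measurable_EFinP.
  exact: measurable_prod_tnth.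
- by move=> y; rewrite mule_ge0// lee_fin prodr_ge0// => i _; exact: g0.
transitivity (\int[mu ord0]_a \int[behead nu]_y (F (cons_pair (a, y)) * (G y)%:E)).
  apply: eq_integral => a _.
  rewrite (IH _ (fun i => nu (lift ord0 i)) (fun i => g (lift ord0 i)))//.
  - by move=> i; exact: dens.
  - exact: (measurable_fun_pair2 a mFc).
rewrite dens; last 2 first.
- apply: (measurable_fun_fubini_tonelli_F _ mFG) => z.
  by rewrite mule_ge0// lee_fin.
- by move=> a; apply: integral_ge0 => y _; rewrite mule_ge0// lee_fin.
apply: eq_integral => a _.
rewrite -ge0_integralZr//; last 3 first.
- exact: (measurable_fun_pair2 a mFG).
- by move=> y _; rewrite mule_ge0// lee_fin.
- by rewrite lee_fin.
apply: eq_integral => y _; rewrite -muleA -EFinM big_ord_recl tnth_cons_pair0 mulrC.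
by congr (_ * (_ * _)%:E); apply: eq_bigr => i _; rewrite tnth_cons_pairS.
Qed.

(** The formula for nonnegative functions passes to positive and negative parts
without any integrability, since the density is nonnegative. *)
Lemma integral_prod_law_density n (mu nu : 'I_n -> probability T R)
    (g : 'I_n -> T -> R) :
  (forall i, measurable_fun setT (g i)) -> (forall i a, (0 <= g i a)%R) ->
  (forall i (F : T -> \bar R), measurable_fun setT F -> (forall a, 0 <= F a) ->
    \int[mu i]_a F a = \int[nu i]_a (F a * (g i a)%:E)) ->
  forall f : n.-tuple T -> R, measurable_fun setT f ->
  \int[prod_law mu]_y (f y)%:E =
  \int[prod_law nu]_y (f y * \prod_(i < n) g i (tnth y i))%:E.
Proof.
move=> mg g0 dens f mf.
have mF : measurable_fun setT (EFin \o f) by exact/measurable_EFinP.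
rewrite integralE [RHS]integralE.
rewrite (prod_law_density mg g0 dens (measurable_funepos mF))//.
rewrite (prod_law_density mg g0 dens (measurable_funeneg mF))//.
have G0 (y : n.-tuple T) : 0 <= (\prod_(i < n) g i (tnth y i))%:E.
  by rewrite lee_fin prodr_ge0.
congr (_ - _); apply: eq_integral => y _.
  by rewrite !funeposE EFinM -[in RHS](mul0e (\prod_(i < n) g i (tnth y i))%:E) maxe_pMl.
rewrite !funenegE EFinM -[in RHS](mul0e (\prod_(i < n) g i (tnth y i))%:E) -mulNe.
by rewrite maxe_pMl.
Qed.

Lemma integral_prod_law_prod n (nu : 'I_n -> probability T R) (a : 'I_n -> T -> R) :
  (forall i, (nu i).-integrable setT (EFin \o a i)) ->
  (prod_law nu).-integrable setT (fun y => (\prod_(i < n) a i (tnth y i))%:E) /\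
  (\int[prod_law nu]_y (\prod_(i < n) a i (tnth y i)) =
  \prod_(i < n) \int[nu i]_x a i x)%R.
Proof.
elim: n nu a => [|n IH] nu a ia.
  split; last by under eq_Rintegral do rewrite big_ord0; rewrite mean_cst big_ord0.
  under eq_fun do rewrite big_ord0.
  exact: finite_measure_integrable_cst.
have ma i : measurable_fun setT (a i).
  by apply/measurable_EFinP; exact: measurable_int (ia i).
pose b := fun y : n.-tuple T => (\prod_(i < n) a (lift ord0 i) (tnth y i))%R.
have [ib Eb] := IH (fun i => nu (lift ord0 i)) (fun i => a (lift ord0 i))
  (fun i => ia (lift ord0 i)).
have E (z : T * n.-tuple T) :
    (\prod_(i < n.+1) a i (tnth (cons_pair z) i) = a ord0 z.1 * b z.2)%R.
  rewrite big_ord_recl tnth_cons_pair0; congr (_ * _)%R.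
  by apply: eq_bigr => i _; rewrite tnth_cons_pairS.
have mb : measurable_fun setT b.
  exact: (@measurable_prod_tnth n (fun i => a (lift ord0 i)) (fun i => ma _)).
have mab : measurable_fun setT
    (fun z : T * n.-tuple T => (a ord0 z.1 * b z.2)%:E).
  by apply/measurable_EFinP; apply: measurable_funM; exact: measurableT_comp.
have iab : (nu ord0 \x behead nu).-integrable setT
    (fun z : T * n.-tuple T => (a ord0 z.1 * b z.2)%:E).
  apply/(integrable12ltyP _ _ mab).
  under eq_integral => x _ do
    under eq_integral => y _ do rewrite /= normrM EFinM.
  under eq_integral => x _.
    rewrite ge0_integralZl//; last by apply/measurable_EFinP; exact: measurableT_comp.
    over.
  have /integrableP[_ ib'] := ib; have /integrableP[_ ia'] := ia ord0.
  rewrite ge0_integralZr//; last 2 first.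
  - by apply/measurable_EFinP; exact: measurableT_comp.
  - exact: integral_ge0.
  apply: lte_mul_pinfty; [exact: integral_ge0| |exact: ib'].
  by rewrite ge0_fin_numE//; exact: integral_ge0.
have iE : (prod_law nu).-integrable setT
    (fun y => (\prod_(i < n.+1) a i (tnth y i))%:E).
  have mE : measurable_fun setT
      (fun y : n.+1.-tuple T => (\prod_(i < n.+1) a i (tnth y i))%:E).
    by apply/measurable_EFinP; exact: (@measurable_prod_tnth n.+1 a ma).
  apply/integrableP; split; first exact: mE.
  rewrite [X in X < _]ge0_integral_distribution//; last exact: measurableT_comp.
  under eq_integral => z _ do rewrite /= E.
  by have /integrableP[] := iab.
split => //.
rewrite /Rintegral integral_prod_lawS//.
under eq_integral => z _ do rewrite E.
rewrite -(integral12_prod_meas1 iab) /fubini_F/=.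
under eq_integral => x _.
  under eq_integral => y _ do rewrite EFinM.
  rewrite /= integralZl// (EFin_Rintegral ib).
  over.
rewrite (integralZr measurableT (ia ord0)) (EFin_Rintegral (ia ord0)) -EFinM/=.
by rewrite big_ord_recl; congr (_ * _)%R; exact: Eb.
Qed.

(** The coordinate carrying [h] is integrated first; the other factor does not
see it. *)
Lemma integral_prod_law_centered n (nu : 'I_n -> probability T R) (i0 : 'I_n)
    (f : n.-tuple T -> R) (h : T -> R) :
  measurable_fun setT f ->
  (forall y y', (forall i, i != i0 -> tnth y i = tnth y' i) -> f y = f y') ->
  (nu i0).-integrable setT (EFin \o h) -> (\int[nu i0]_x h x = 0)%R ->
  (prod_law nu).-integrable setT (fun y => (f y * h (tnth y i0))%:E) ->
  \int[prod_law nu]_y (f y * h (tnth y i0))%:E = 0.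
Proof.
elim: n nu i0 f => [|n IH] nu i0 f; first by case: i0.
case: (unliftP ord0 i0) => [j ->|->] mf indep ih h0 ifh.
  have mfc a : measurable_fun setT (fun y => f (cons_pair (a, y))).
    apply: (measurable_fun_pair2 (f := f \o @cons_pair _ T n)).
    by apply: measurableT_comp => //; exact: measurable_cons_pair.
  have ifc := integrable_prod_lawS ifh.
  rewrite integral_prod_lawS// -(integral12_prod_meas1 ifc) /fubini_F/=.
  transitivity (\int[nu ord0]_x (cst 0 x)); last by rewrite integral0.
  apply: ae_eq_integral => //; first exact: (measurable_fubini_F ifc).
  apply: filterS (ae_integrable1 ifc) => a /= iy _.
  under eq_integral => y _ do rewrite tnth_cons_pairS/=.
  apply: IH => //; last first.
    by move: iy; under [X in _.-integrable _ X]eq_fun do rewrite tnth_cons_pairS.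
  move=> y y' yy'; apply: indep => i ij.
  case: (unliftP ord0 i) ij => [k ->|-> _]; last by rewrite !tnth_cons_pair0.
  rewrite !tnth_cons_pairS /= => kj; apply: yy'.
  by apply: contraNneq kj => ->.
have [a0 _] : exists a0 : T, True.
  apply: contrapT => Tempty.
  have T0 : [set: T] = set0 by apply/seteqP; split => // a _; apply: Tempty; exists a.
  have := probability_setT (nu ord0); rewrite T0 measure0 => /eqP.
  by rewrite eq_sym onee_eq0.
have ifc := integrable_prod_lawS ifh.
rewrite integral_prod_lawS// -(integral21_prod_meas1 ifc) /fubini_G/=.
apply: integral0_eq => y _.
under eq_integral => a _.
  rewrite tnth_cons_pair0 /= (indep (cons_pair (a, y)) (cons_pair (a0, y))); last first.
    move=> i; case: (unliftP ord0 i) => [k -> _|->]; last by rewrite eqxx.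
    by rewrite !tnth_cons_pairS.
  rewrite EFinM.
  over.
by rewrite integralZl// (EFin_Rintegral ih) h0 mule0.
Qed.

End product_laws.

(** * Likelihood ratios of the channel *)

Section channel_density.
Context d (Omega : measurableType d) (R : realType) (P : channel Omega R).

(** The nonnegative version of the likelihood ratio, to which the change of
measure applies without an almost-everywhere proviso. *)
Definition density x (y : Omega) : R :=
  fine (Radon_Nikodym_SigmaFinite.f (P x) (P 0) y).

Lemma density_ge0 x y : 0 <= density x y.
Proof.
rewrite /density /Radon_Nikodym_SigmaFinite.f; case: pselect => // Px.
by case: cid => g [g0 _ _ _] /=; exact: fine_ge0.
Qed.

Section absolutely_continuous.
Variable x : R.
Hypothesis Px : P x `<< P 0.

Lemma EFin_density y : (density x y)%:E = Radon_Nikodym_SigmaFinite.f (P x) (P 0) y.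
Proof. by rewrite fineK// Radon_Nikodym_SigmaFinite.f_fin_num. Qed.

Lemma measurable_density : measurable_fun setT (density x).
Proof.
apply: measurableT_comp => //.
exact: measurable_int (Radon_Nikodym_SigmaFinite.f_integrable Px).
Qed.

Lemma integral_density (F : Omega -> \bar R) :
  measurable_fun setT F -> (forall y, (0 <= F y)%E) ->
  (\int[P x]_y F y = \int[P 0%R]_y (F y * (density x y)%:E))%E.
Proof.
move=> mF F0; under [RHS]eq_integral => y _ do rewrite EFin_density.
by rewrite Radon_Nikodym_SigmaFinite.change_of_variables.
Qed.

Lemma ae_eq_density : ae_eq (P 0) setT (likelihood_ratio P x) (density x).
Proof.
have := @ae_eq_Radon_Nikodym_SigmaFinite _ _ _ (P x) (P 0) Px setT measurableT.
by apply: filterS => y H yT; rewrite /likelihood_ratio /density (H yT).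
Qed.

End absolutely_continuous.

Definition excess x y : R := density x y - 1.

Hypothesis hgood : good P.

Let PxP0 x : signals P x -> P x `<< P 0.
Proof. by move=> sx; case: (hgood.2 x sx). Qed.

Lemma L2_density x : signals P x -> density x \in Lfun (P 0) 2%:E.
Proof.
move=> sx; have mdx := measurable_density (PxP0 sx).
have [_ lr] := hgood.2 x sx; have mlr := L2_measurable lr.
apply: L2_intro => //.
have /integrableP[mlr2 ilr2] := Lfun2_integrable_sqr lr.
have mdx2 : measurable_fun setT (EFin \o (fun y => density x y ^+ 2)).
  by apply/measurable_EFinP; exact: measurable_funX.
apply/integrableP; split; first exact: mdx2.
move: ilr2; congr (_ < _)%E; apply: ae_eq_integral => //.
- exact: measurableT_comp.
- exact: measurableT_comp.
by apply: filterS (ae_eq_density (PxP0 sx)) => y H yT /=; rewrite H.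
Qed.

Lemma L2_excess x : signals P x -> excess x \in Lfun (P 0) 2%:E.
Proof.
move=> sx; rewrite (_ : excess x = fun y => density x y + -1)//.
by apply: L2D; [exact: L2_density|exact: L2_cst].
Qed.

Lemma excess_integrable x : signals P x ->
  (P 0).-integrable setT (EFin \o excess x).
Proof.
move=> /L2_excess lx; have := L2_integrable_mul (L2_cst (P 0) 1) lx.
by apply: eq_integrable => // y _ /=; rewrite mul1r.
Qed.

Lemma mean_excess x : signals P x -> \int[P 0]_y excess x y = 0.
Proof.
move=> sx; rewrite /excess RintegralB//; last 2 first.
- have := L2_integrable_mul (L2_cst (P 0) 1) (L2_density sx).
  by apply: eq_integrable => // y _ /=; rewrite mul1r.
- exact: finite_measure_integrable_cst.
rewrite mean_cst; apply/eqP; rewrite subr_eq0; apply/eqP.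
rewrite /Rintegral (_ : (\int[P 0%R]_y (density x y)%:E)%E = 1%E)//.
have E1 : (\int[P x]_y 1%:E = 1)%E.
  by rewrite (EFin_Rintegral (bmeas_integrable (P x) (bmeas_cst _ 1))) mean_cst.
rewrite -[RHS]E1 (integral_density (PxP0 sx))//.
by apply: eq_integral => y _; rewrite mul1e.
Qed.

Lemma overlap_excess x x' : signals P x -> signals P x' ->
  overlap P x x' = \int[P 0]_y (excess x y * excess x' y).
Proof.
move=> sx sx'; rewrite /overlap unlock /Rintegral; congr fine.
have [_ lx] := hgood.2 x sx; have [_ lx'] := hgood.2 x' sx'.
apply: ae_eq_integral => //.
- apply/measurable_EFinP; apply: measurable_funM.
    exact: measurable_funB (L2_measurable lx) (measurable_cst _).
  exact: measurable_funB (L2_measurable lx') (measurable_cst _).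
- apply/measurable_EFinP; apply: measurable_funM.
    exact: L2_measurable (L2_excess sx).
  exact: L2_measurable (L2_excess sx').
have H1 := ae_eq_density (PxP0 sx); have H2 := ae_eq_density (PxP0 sx').
by apply: filterS2 H1 H2 => y e1 e2 yT /=; rewrite e1// e2.
Qed.

Lemma overlapC x x' : overlap P x x' = overlap P x' x.
Proof.
rewrite /overlap; congr fine; congr expectation.
by apply/funext => y; rewrite mulrC.
Qed.

Lemma overlap_diag_ge0 x : 0 <= overlap P x x.
Proof.
rewrite /overlap unlock fine_ge0// integral_ge0// => y _.
by rewrite lee_fin -expr2 sqr_ge0.
Qed.

Lemma measurable_likelihood_ratio x : measurable_fun setT (likelihood_ratio P x).
Proof.
apply: measurableT_comp => //.
have [Px|nPx] := pselect (P x `<< P 0).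
  have /measurable_int := @Radon_Nikodym_integrable _ _ _
    (charge_of_finite_measure (P x)) (P 0) Px.
  exact.
by rewrite /Radon_Nikodym; case: pselect => // Px; exact: measurable_cst.
Qed.

(** The likelihood ratio at signal 0 is almost surely 1. *)
Lemma overlap0 x : overlap P 0 x = 0.
Proof.
have P00 := PxP0 (signals0 P).
have R1 : ae_eq (P 0) setT
    (Radon_Nikodym (charge_of_finite_measure (P 0)) (P 0)) (cst 1%E).
  apply: integral_ae_eq => //; first exact: Radon_Nikodym_integrable.
  move=> B _ mB.
  rewrite -Radon_Nikodym_integral// integral_cst// mul1e.
  by [].

rewrite /overlap expectation.unlock -[RHS]/(fine 0%E); congr fine.
transitivity (\int[P 0%R]_y (cst 0%E y))%E; last by rewrite integral0.
apply: ae_eq_integral => //.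
  apply/measurable_EFinP; apply: measurable_funM.
    exact: measurable_funB (measurable_likelihood_ratio 0) (measurable_cst _).
  exact: measurable_funB (measurable_likelihood_ratio x) (measurable_cst _).
by apply: filterS R1 => y H yT; rewrite /likelihood_ratio (H yT) /= subrr mul0r.
Qed.

End channel_density.

(** * Low-degree part of the likelihood ratio *)

Section chaos.
Context d (Omega : measurableType d) (R : realType) (P : channel Omega R).
Hypothesis hgood : good P.
Variable N : nat.
Implicit Types (x : N.-tuple R) (y : N.-tuple Omega) (T : {set 'I_N}).

Local Notation Q := (null_law P N).
Local Notation admissible x := (forall i, signals P (tnth x i)).

Definition chaos T x y : R := \prod_(i in T) excess P (tnth x i) (tnth y i).

Definition low_chaos D x y : R :=
  \sum_(T : {set 'I_N} | (#|T| <= D)%N) chaos T x y.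

(** The inner product of the low-degree parts at two signals ([ip_low_chaos]). *)
Definition overlap_kernel D x x' : R :=
  \sum_(d < D.+1) elem_sym (fun i => overlap P (tnth x i) (tnth x' i)) d.

Let chaosE T x y : chaos T x y =
  \prod_(i < N) (if i \in T then excess P (tnth x i) (tnth y i) else 1).
Proof. by rewrite /chaos big_mkcond. Qed.

Lemma prod_density x y :
  \prod_(i < N) density P (tnth x i) (tnth y i) = \sum_T chaos T x y.
Proof.
under eq_bigr => i _ do rewrite -[density _ _ _](subrK 1).
by rewrite bigA_distr; apply: eq_bigr => T _; rewrite chaosE.
Qed.

Let excess1 x i (b : bool) (z : Omega) : R := if b then excess P (tnth x i) z else 1.

Let L2_excess1 x i b : admissible x -> excess1 x i b \in Lfun (P 0) 2%:E.
Proof. by move=> sx; case: b; [exact: L2_excess|exact: L2_cst]. Qed.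

Let ip_excess1 x x' i b b' : admissible x -> admissible x' ->
  ip (P 0) (excess1 x i b) (excess1 x' i b') =
  if b then (if b' then overlap P (tnth x i) (tnth x' i) else 0)
  else (if b' then 0 else 1).
Proof.
move=> sx sx'; case: b; case: b'; rewrite /ip /excess1.
- by rewrite overlap_excess.
- by under eq_Rintegral do rewrite mulr1; rewrite mean_excess.
- by under eq_Rintegral do rewrite mul1r; rewrite mean_excess.
- by under eq_Rintegral do rewrite mul1r; rewrite mean_cst.
Qed.

Let mul_chaosE T S x x' y : chaos T x y * chaos S x' y =
  \prod_(i < N) (excess1 x i (i \in T) (tnth y i) * excess1 x' i (i \in S) (tnth y i)).
Proof. by rewrite !chaosE -big_split. Qed.

Let chaos_product T S x x' : admissible x -> admissible x' ->
  Q.-integrable setT (fun y => (chaos T x y * chaos S x' y)%:E) /\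
  \int[Q]_y (chaos T x y * chaos S x' y) =
  \prod_(i < N) ip (P 0) (excess1 x i (i \in T)) (excess1 x' i (i \in S)).
Proof.
move=> sx sx'.
have [iQ EQ] := @integral_prod_law_prod _ Omega R N (fun=> P 0)
  (fun i z => excess1 x i (i \in T) z * excess1 x' i (i \in S) z)
  (fun i => L2_integrable_mul (L2_excess1 _ _ sx) (L2_excess1 _ _ sx')).
split; first by under eq_fun do rewrite mul_chaosE.
by under eq_Rintegral do rewrite mul_chaosE; rewrite EQ.
Qed.

Lemma measurable_chaos T x : admissible x -> measurable_fun setT (chaos T x).
Proof.
move=> sx; rewrite (_ : chaos T x =
    fun y => \prod_(i < N) excess1 x i (i \in T) (tnth y i)); last first.
  by apply/funext => y; rewrite chaosE.
apply: (@measurable_prod_tnth _ _ _ _ (fun i => excess1 x i (i \in T))) => i.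
exact: L2_measurable (L2_excess1 _ _ sx).
Qed.

Lemma L2_chaos T x : admissible x -> chaos T x \in Lfun Q 2%:E.
Proof.
move=> sx; apply: L2_intro; first exact: measurable_chaos.
by under eq_fun do rewrite expr2; have [] := chaos_product T T sx sx.
Qed.

(** Distinct sets of coordinates give orthogonal products, because a centred
factor is left alone in some coordinate. *)
Lemma ip_chaos T S x x' : admissible x -> admissible x' ->
  ip Q (chaos T x) (chaos S x') =
  if T == S then \prod_(i in T) overlap P (tnth x i) (tnth x' i) else 0.
Proof.
move=> sx sx'; have [_] := chaos_product T S sx sx'; rewrite /ip => ->.
have [<-|TS] := eqVneq T S.
  rewrite [RHS]big_mkcond; apply: eq_bigr => i _; rewrite -/(ip _ _ _) ip_excess1//.
  by case: (i \in T).
have [i iTS] : exists i, (i \in T) != (i \in S).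
  apply/existsP; apply: contraNT TS => /existsPn H.
  by apply/eqP/setP => i; apply/eqP; have := H i; rewrite negbK.
rewrite (bigD1 i)//= -/(ip _ _ _) ip_excess1//.
by move: iTS; case: (i \in T); case: (i \in S) => //; rewrite mul0r.
Qed.

Lemma L2_low_chaos D x : admissible x -> low_chaos D x \in Lfun Q 2%:E.
Proof. by move=> sx; apply: L2_sum => T _; exact: L2_chaos. Qed.

Lemma ip_sum_chaos (p : pred {set 'I_N}) x x' : admissible x -> admissible x' ->
  ip Q (fun y => \sum_(T : {set 'I_N} | p T) chaos T x y)
       (fun y => \sum_(T : {set 'I_N} | p T) chaos T x' y) =
  \sum_(T : {set 'I_N} | p T) \prod_(i in T) overlap P (tnth x i) (tnth x' i).
Proof.
move=> sx sx'.
have lp x0 : admissible x0 ->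
    (fun y => \sum_(T : {set 'I_N} | p T) chaos T x0 y) \in Lfun Q 2%:E.
  by move=> sx0; apply: L2_sum => T _; exact: L2_chaos.
rewrite ip_suml; [|by move=> T _; exact: L2_chaos|exact: lp].
apply: eq_bigr => T pT.
rewrite ip_sumr; [|by move=> S _; exact: L2_chaos|exact: L2_chaos].
rewrite (bigD1 T)//= [X in _ + X]big1; last first.
  by move=> S /andP[_ ST]; rewrite ip_chaos// eq_sym (negbTE ST).
by rewrite addr0 ip_chaos// eqxx.
Qed.

Lemma ip_low_chaos D x x' : admissible x -> admissible x' ->
  ip Q (low_chaos D x) (low_chaos D x') = overlap_kernel D x x'.
Proof. by move=> sx sx'; rewrite /overlap_kernel sum_elem_sym; exact: ip_sum_chaos. Qed.

Lemma coord_space_low_chaos D x : admissible x ->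
  coord_space_le P D (low_chaos D x).
Proof.
move=> sx; exists (fun T => chaos T x) => // T _; split; first exact: L2_chaos.
by move=> y y' yy'; apply: eq_bigr => i iT; rewrite yy'.
Qed.

Lemma coord_space_le_L2 D f : coord_space_le P D f -> f \in Lfun Q 2%:E.
Proof. by move=> [g gT ->]; apply: L2_sum => T /gT[]. Qed.

Lemma L2_prod_density x : admissible x ->
  (fun y => \prod_(i < N) density P (tnth x i) (tnth y i)) \in Lfun Q 2%:E.
Proof.
move=> sx; under eq_fun do rewrite prod_density.
by apply: L2_sum => T _; exact: L2_chaos.
Qed.

(** Products over more than [D] coordinates are orthogonal to functions of at
most [D] coordinates, so only the low-degree part of the likelihood ratio is
seen. *)
Lemma ip_prod_density D f x : admissible x -> coord_space_le P D f ->
  ip Q f (fun y => \prod_(i < N) density P (tnth x i) (tnth y i)) =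
  ip Q f (low_chaos D x).
Proof.
move=> sx [g gT ->].
have lg T : (#|T| <= D)%N -> g T \in Lfun Q 2%:E by move=> /gT[].
under [X in ip _ _ X]eq_fun do rewrite prod_density.
rewrite !ip_suml//; last 2 first.
- exact: L2_low_chaos.
- by apply: L2_sum => T _; exact: L2_chaos.
apply: eq_bigr => S SD.
rewrite ip_sumr; [|by move=> T _; exact: L2_chaos|exact: lg].
rewrite ip_sumr; [|by move=> T _; exact: L2_chaos|exact: lg].
rewrite (bigID (fun T : {set 'I_N} => (#|T| <= D)%N))/= [X in _ + X]big1 ?addr0// => T.
rewrite -ltnNge => DT.
have [i iT iS] : exists2 i, i \in T & i \notin S.
  apply/subsetPn; apply: contraL DT => /subset_leq_card TS.
  by rewrite -leqNgt (leq_trans TS).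
have E y : g S y * chaos T x y =
    (g S y * chaos (T :\ i) x y) * excess P (tnth x i) (tnth y i).
  by rewrite -mulrA; congr (_ * _); rewrite /chaos (big_setD1 i)//= mulrC.
have [lgS indep] := gT S SD.
rewrite /ip; under eq_Rintegral do rewrite E.
rewrite /Rintegral integral_prod_law_centered//.
- apply: measurable_funM; first exact: L2_measurable lgS.
  exact: measurable_chaos.
- move=> y y' yy'; congr (_ * _).
    by apply: indep => j jS; apply: yy'; apply: contraNneq iS => <-.
  apply: eq_bigr => j; rewrite !inE => /andP[ji _].
  by rewrite (yy' j ji).
- exact: excess_integrable.
- exact: mean_excess.
have := L2_integrable_mul lgS (L2_chaos T sx).
by under eq_fun do rewrite E.
Qed.

Lemma integral_obs_law f x : admissible x -> measurable_fun setT f ->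
  (\int[obs_law P x]_y (f y)%:E =
   \int[Q]_y (f y * \prod_(i < N) density P (tnth x i) (tnth y i))%:E)%E.
Proof.
move=> sx mf.
apply: (@integral_prod_law_density _ Omega R N (fun i => P (tnth x i)) (fun=> P 0)
  (fun i => density P (tnth x i))) => //.
- by move=> i; exact: (measurable_density (hgood.2 _ (sx i)).1).
- by move=> i a; exact: density_ge0.
- by move=> i F mF F0; exact: (integral_density (hgood.2 _ (sx i)).1).
Qed.

End chaos.

(** * The coordinate advantage as a mean overlap *)

Section coordinate_advantage.
Context d (Omega : measurableType d) (R : realType) (P : channel Omega R).
Hypothesis hgood : good P.
Variables (A : R) (U : set (R * R)).
Hypothesis A0 : 0 < A.
Hypothesis squareU : `[- A, A] `*` `[- A, A] `<=` U.
Hypothesis Usignals : U `<=` signals P `*` signals P.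
Hypothesis overlap_continuous :
  forall p, U p -> {for p, continuous (fun q : R * R => overlap P q.1 q.2)}.

Variables (N : nat) (X0 : probability (N.-tuple R) R).
Context d' (T : measurableType d') (X : probability T R) (r : T -> N.-tuple R).
Hypothesis mr : measurable_fun setT r.
Hypothesis rA : forall t i, `|tnth (r t) i| <= A.
Hypothesis X0E : forall B, measurable B -> X0 B = X (r @^-1` B).

Local Notation Q := (null_law P N).
Implicit Types f g : N.-tuple Omega -> R.

Lemma r_signals t i : signals P (tnth (r t) i).
Proof. by have [] := Usignals (square_sub squareU (rA t i) (rA t i)). Qed.

Lemma bmeas_overlap_elem_sym d1 (S : measurableType d1) (f g : S -> T) n :
  measurable_fun setT f -> measurable_fun setT g ->
  bmeas (fun s => elem_sym
    (fun i => overlap P (tnth (r (f s)) i) (tnth (r (g s)) i)) n).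
Proof.
move=> mf mg; rewrite /elem_sym; apply: bmeas_sum => B _; apply: bmeas_prod => i _.
have mri h : measurable_fun setT h ->
    measurable_fun setT (fun s : S => tnth (r (h s)) i).
  move=> mh; exact: (measurableT_comp (measurable_tnth i) (measurableT_comp mr mh)).
by apply: (bmeas_square_kernel A0 squareU overlap_continuous) => //; exact: mri.
Qed.

Lemma bmeas_overlap_kernel d1 (S : measurableType d1) (f g : S -> T) D :
  measurable_fun setT f -> measurable_fun setT g ->
  bmeas (fun s => overlap_kernel P D (r (f s)) (r (g s))).
Proof.
move=> mf mg; rewrite /overlap_kernel; apply: bmeas_sum => n _.
exact: bmeas_overlap_elem_sym.
Qed.

Let L t y := \prod_(i < N) density P (tnth (r t) i) (tnth y i).

Let lL t : L t \in Lfun Q 2%:E.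
Proof. exact: L2_prod_density (r_signals t). Qed.

Let L2_norm f : f \in Lfun Q 2%:E -> (fun y => `|f y|) \in Lfun Q 2%:E.
Proof.
move=> lf; apply: L2_intro.
  by apply: measurableT_comp => //; exact: L2_measurable lf.
under eq_fun do rewrite real_normK ?num_real//.
exact: Lfun2_integrable_sqr.
Qed.

Let mobs : measurable_fun setT (fun t => obs_law P (r t) : giry (N.-tuple Omega) R).
Proof.
apply: measurable_giry_codensity => // B mB.
exact: (measurableT_comp (measurable_obs_law P mB) mr).
Qed.

(** The likelihood ratio has a norm bounded uniformly in [t], because the overlap is
bounded on the square; this makes all means below finite. *)
Let integral_abs_obs_law f : f \in Lfun Q 2%:E ->
  exists M : R, forall t, (\int[obs_law P (r t)]_y `|f y|%:E <= M%:E)%E.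
Proof.
move=> lf; have laf := L2_norm lf.
have [_ [B KB]] := @bmeas_overlap_kernel _ T id id N
  (@measurable_id _ _ _) (@measurable_id _ _ _).
exists ((ip Q f f + B) / 2) => t.
rewrite (integral_obs_law hgood (r_signals t)); last exact: L2_measurable laf.
rewrite (EFin_Rintegral (L2_integrable_mul laf (lL t))) lee_fin -/(ip Q _ (L t)).
have LB : ip Q (L t) (L t) <= B.
  have -> : L t = low_chaos P N (r t).
    apply/funext => y; rewrite /L prod_density /low_chaos.
    by apply: eq_bigl => S; rewrite -[X in (_ <= X)%N]card_ord max_card.
  rewrite ip_low_chaos//; last 2 first.
  - exact: r_signals.
  - exact: r_signals.
  exact: le_trans (ler_norm _) (KB t).
have := ip_ge0 Q (fun y => `|f y| + -1 * L t y).
have lm : (fun y => -1 * L t y) \in Lfun Q 2%:E by exact: L2Z.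
pose k y := `|f y| + -1 * L t y.
have lk : k \in Lfun Q 2%:E by exact: L2D.
have Ek h : h \in Lfun Q 2%:E ->
    ip Q k h = ip Q (fun y => `|f y|) h + -1 * ip Q (L t) h.
  by move=> lh; rewrite /k ipDl// ipZl.
rewrite -/k Ek// [ip Q _ k]ipC [ip Q (L t) k]ipC !Ek//.
rewrite [ip Q (L t) (fun y => _)]ipC.
have -> : ip Q (fun y => `|f y|) (fun y => `|f y|) = ip Q f f.
  by apply: eq_Rintegral => y _; rewrite -!expr2 real_normK ?num_real.
lra.
Qed.

(** The planted law is the mixture of the laws [obs_law P (r t)] over [X]. *)
Let ge0_integral_planted (F : N.-tuple Omega -> \bar R) :
  measurable_fun setT F -> (forall y, 0 <= F y)%E ->
  (\int[planted P X0]_y F y = \int[X]_t \int[obs_law P (r t)]_y F y)%E.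
Proof.
move=> mF F0.
rewrite (eq_measure_integral (giry_bind (X : giry T R) mobs)).
  exact: giry_int_bind.
move=> B mB _; rewrite /giry_bind/= /giry_int/=.
rewrite [RHS](_ : _ = giry_int (giry_map mobs (X : giry T R)) (giry_ev ^~ B))//.
rewrite giry_int_map//; last exact: measurable_giry_ev.
rewrite /giry_int /planted (eq_measure_integral (giry_map mr (X : giry T R))).
  exact: (giry_int_map mr (X : giry T R) (measurable_obs_law P mB)
    (fun x => measure_ge0 (obs_law P x) B)).
by move=> C mC _; exact: X0E.
Qed.

(** Under each signal, the mean of [f] is its inner product with the likelihood
ratio. It is measurable in the signal because the channel is a kernel, although
the likelihood ratio itself need not be. *)
Lemma mean_planted f : f \in Lfun Q 2%:E ->
  bmeas (fun t => ip Q f (L t)) /\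
  (\int[planted P X0]_y (f y)%:E)%E = (\int[X]_t ip Q f (L t))%:E.
Proof.
move=> lf; have mf := L2_measurable lf.
have mF : measurable_fun setT (EFin \o f) by exact/measurable_EFinP.
have [M HM] := integral_abs_obs_law lf.
have part (G : N.-tuple Omega -> \bar R) : measurable_fun setT G ->
    (forall y, 0 <= G y)%E -> (forall y, G y <= `|f y|%:E)%E ->
    bmeas (fun t => fine (\int[obs_law P (r t)]_y G y)%E) /\
    forall t, (\int[obs_law P (r t)]_y G y)%E =
      (fine (\int[obs_law P (r t)]_y G y)%E)%:E.
  move=> mG G0 Gf.
  have I0 t : (0 <= \int[obs_law P (r t)]_y G y)%E by exact: integral_ge0.
  have IM t : (\int[obs_law P (r t)]_y G y <= M%:E)%E.
    apply: le_trans (HM t); apply: ge0_le_integral => //.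
    by apply/measurable_EFinP; exact: measurableT_comp.
  have Ifin t : (\int[obs_law P (r t)]_y G y)%E \is a fin_num.
    by rewrite ge0_fin_numE// (le_lt_trans (IM t))// ltry.
  split; last by move=> t; rewrite fineK.
  split; last first.
    by exists M => t; rewrite ger0_norm ?fine_ge0// -lee_fin fineK.
  apply: measurableT_comp => //.
  exact: (measurableT_comp (measurable_giry_int mG G0) mobs).
have abs_pos y : ((EFin \o f)^\+ y <= `|f y|%:E)%E.
  by rewrite funeposE /= ge_max !lee_fin ler_norm normr_ge0.
have abs_neg y : ((EFin \o f)^\- y <= `|f y|%:E)%E.
  by rewrite funenegE /= ge_max !lee_fin -normrN ler_norm normr_ge0.
have [bp Ep] := part _ (measurable_funepos mF) (funepos_ge0 _) abs_pos.
have [bm Em] := part _ (measurable_funeneg mF) (funeneg_ge0 _) abs_neg.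
set up := (fun t => fine _) in bp Ep; set um := (fun t => fine _) in bm Em.
have E t : ip Q f (L t) = up t - um t.
  have := integral_obs_law hgood (r_signals t) mf.
  rewrite integralE Ep Em => /(congr1 fine) /= H.
  by rewrite /up /um H.
have -> : (fun t => ip Q f (L t)) = (fun t => up t - um t) by apply/funext.
split; first exact: bmeasB.
rewrite integralE !ge0_integral_planted//; last 2 first.
- exact: measurable_funeneg.
- exact: measurable_funepos.
under eq_integral => t _ do rewrite Ep.
under [X in (_ - X)%E]eq_integral => t _ do rewrite Em.
rewrite !EFin_Rintegral; last 2 first.
- exact: bmeas_integrable.
- exact: bmeas_integrable.
by rewrite -EFinB -meanB.
Qed.

(** A Gram kernel again, that of the part of degree exactly [n] of the likelihood
ratio. *)
Lemma mean_overlap_elem_sym_ge0 n :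
  0 <= \int[(X \x X)%E]_z elem_sym
    (fun i => overlap P (tnth (r z.1) i) (tnth (r z.2) i)) n.
Proof.
pose c t y := \sum_(B : {set 'I_N} | #|B| == n) chaos P B (r t) y.
have lc t : c t \in Lfun Q 2%:E.
  by apply: L2_sum => B _; exact: L2_chaos (r_signals t).
have E t t' : elem_sym (fun i => overlap P (tnth (r t) i) (tnth (r t') i)) n =
    ip Q (c t) (c t').
  by rewrite ip_sum_chaos//; exact: r_signals.
apply: psd_mean_ge0 => [|t t'|s] /=.
- by apply: bmeas_overlap_elem_sym; [exact: measurable_fst|exact: measurable_snd].
- by rewrite !E ipC.
under eq_bigr => t _ do under eq_bigr => t' _ do rewrite E.
under eq_bigr => t _ do rewrite -ip_sumr//.
by rewrite -ip_suml// ?ip_ge0//; apply: L2_sum => t _; exact: lc.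
Qed.

Variable D : nat.

Let low t := low_chaos P D (r t).

Let llow t : low t \in Lfun Q 2%:E.
Proof. exact: L2_low_chaos (r_signals t). Qed.

Let phi f t := ip Q f (low t).

Let mean_planted_low f : coord_space_le P D f ->
  bmeas (phi f) /\ ('E_(planted P X0)[f] = (\int[X]_t phi f t)%:E)%E.
Proof.
move=> cf; have [] := mean_planted (coord_space_le_L2 cf).
have -> : (fun t => ip Q f (L t)) = phi f.
  by apply/funext => t; exact: (ip_prod_density hgood (r_signals t) cf).
by rewrite unlock.
Qed.

Let K (z : T * T) := overlap_kernel P D (r z.1) (r z.2).

Let bK : bmeas K.
Proof.
by apply: bmeas_overlap_kernel; [exact: measurable_fst|exact: measurable_snd].
Qed.

Let KE t t' : K (t, t') = ip Q (low t) (low t').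
Proof. by rewrite ip_low_chaos//; exact: r_signals. Qed.

Let Ksym t t' : K (t, t') = K (t', t).
Proof. by rewrite !KE ipC. Qed.

Let sample (s : seq T) y := \sum_(t <- s) low t y.

Let lsample s : sample s \in Lfun Q 2%:E.
Proof. by apply: L2_sum => t _; exact: llow. Qed.

Let ip_sample s f : f \in Lfun Q 2%:E -> ip Q f (sample s) = \sum_(t <- s) phi f t.
Proof. by move=> lf; rewrite ip_sumr. Qed.

Let gram s : \sum_(t <- s) \sum_(t' <- s) K (t, t') = ip Q (sample s) (sample s).
Proof.
rewrite ip_sample//; apply: eq_bigr => t _; rewrite /phi ipC ip_sample//.
by apply: eq_bigr => t' _; rewrite KE.
Qed.

Let coord_space_le0 : coord_space_le P D (fun _ : N.-tuple Omega => 0 : R).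
Proof.
exists (fun _ _ => 0) => [B _|]; last by apply/funext => y; rewrite big1.
by split => //; exact: L2_cst.
Qed.

Let coord_space_leZ c f : coord_space_le P D f -> coord_space_le P D (fun y => c * f y).
Proof.
move=> [g gT ->]; exists (fun B y => c * g B y) => [B BD|].
  have [lg ig] := gT _ BD; split; first exact: L2Z.
  by move=> y y' yy'; rewrite (ig y y').
by apply/funext => y; rewrite mulr_sumr.
Qed.

Let coord_space_leD f g : coord_space_le P D f -> coord_space_le P D g ->
  coord_space_le P D (fun y => f y + g y).
Proof.
move=> [f' fT ->] [g' gT ->]; exists (fun B y => f' B y + g' B y) => [B BD|].
  have [lf jf] := fT _ BD; have [lg jg] := gT _ BD; split; first exact: L2D.
  by move=> y y' yy'; rewrite (jf y y')// (jg y y').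
by apply/funext => y; rewrite big_split.
Qed.

Let coord_space_le_sample s : coord_space_le P D (sample s).
Proof.
rewrite /sample; elim: s => [|t s IH].
  by under eq_fun do rewrite big_nil; exact: coord_space_le0.
under eq_fun do rewrite big_cons; apply: coord_space_leD => //.
exact: (coord_space_low_chaos hgood D (r_signals t)).
Qed.

Let second_moment f : f \in Lfun Q 2%:E ->
  ('E_Q[fun y => (f y ^+ 2)%R] = (ip Q f f)%:E)%E.
Proof.
move=> lf; rewrite unlock /ip -(EFin_Rintegral (L2_integrable_mul lf lf)).
by apply: eq_integral => y _; rewrite expr2.
Qed.

Let S := \int[(X \x X)%E]_z K z.

Let S_ge0 : 0 <= S.
Proof.
apply: psd_mean_ge0 => //; first by move=> s; rewrite gram ip_ge0.
Qed.

(** The optimal statistic is proportional to the prior mean of [low t]. Here it is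
only met through finite samples, on which Bessel's inequality says that the
kernel [K (t, t') - phi f t * phi f t'] is positive. *)
Let mean_le_S f : coord_space_le P D f -> ip Q f f <= 1 ->
  (\int[X]_t phi f t) ^+ 2 <= S.
Proof.
move=> cf f1; have lf := coord_space_le_L2 cf.
have [bphi _] := mean_planted_low cf.
have bpp : bmeas (fun z : T * T => phi f z.1 * phi f z.2).
  by apply: bmeasM; [exact: bmeas_fst|exact: bmeas_snd].
rewrite -subr_ge0 expr2 -mean_tensor// -meanB//.
apply: psd_mean_ge0 => [|t t'|s] /=; first exact: bmeasB.
  by rewrite Ksym mulrC.
under eq_bigr => t _ do rewrite sumrB -mulr_sumr.
rewrite sumrB gram -mulr_suml -expr2 -ip_sample// subr_ge0.
exact: ip_bessel.
Qed.

Let CAdv_le_sqrt : (CAdv P D X0 <= (Num.sqrt S)%:E)%E.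
Proof.
apply: ge_ereal_sup => _ [f [cf Ef] <-].
have f1 : ip Q f f <= 1.
  by move: Ef; rewrite second_moment ?lee_fin//; exact: coord_space_le_L2 cf.
 have [_ ->] := mean_planted_low cf; rewrite lee_fin.
apply: (le_trans (ler_norm _)); rewrite -sqrtr_sqr ler_sqrt//.
exact: mean_le_S.
Qed.

Let CAdv_ge f : coord_space_le P D f -> ip Q f f <= 1 ->
  ((\int[X]_t phi f t)%:E <= CAdv P D X0)%E.
Proof.
move=> cf f1; apply: ereal_sup_ubound; exists f; last first.
  by have [_ ->] := mean_planted_low cf.
by split => //; rewrite second_moment ?lee_fin//; exact: coord_space_le_L2 cf.
Qed.

(** For the lower bound the test functions are the sums of [low t] over finite
samples. With [V] the advantage, that they cannot beat [V] says that
[V ^ 2 K (t, t') - psi t * psi t'] is positive on samples, where [psi t] is the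
mean of [K (t, _)]. Taking means, [V ^ 2 S >= S ^ 2]. *)
Theorem CAdv_sqr : (CAdv P D X0 ^+ 2 = (\int[(X \x X)%E]_z K z)%:E)%E.
Proof.
have phi0 : \int[X]_t phi (fun=> 0) t = 0.
  rewrite /phi /ip; under eq_Rintegral => t _.
    under eq_Rintegral => y _ do rewrite mul0r.
    rewrite mean_cst; over.
  exact: mean_cst.
have V0 : (0 <= CAdv P D X0)%E.
  rewrite -[X in (X <= _)%E]/(0%:E) -phi0; apply: CAdv_ge => //.
  by rewrite /ip; under eq_Rintegral do rewrite mul0r; rewrite mean_cst.
have [V VE] : exists V : R, CAdv P D X0 = V%:E.
  exists (fine (CAdv P D X0)); rewrite fineK// ge0_fin_numE//.
  exact: le_lt_trans CAdv_le_sqrt (ltry _).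
rewrite VE lee_fin in V0.
have VS : V ^+ 2 <= S.
  have := CAdv_le_sqrt; rewrite VE lee_fin => VS.
  by rewrite -(sqr_sqrtr S_ge0) ler_pXn2r// nnegrE sqrtr_ge0.
have mean_le_V f : coord_space_le P D f ->
    (\int[X]_t phi f t) ^+ 2 <= V ^+ 2 * ip Q f f.
  move=> cf; have lf := coord_space_le_L2 cf.
  have [bphi _] := mean_planted_low cf.
  apply/ler_addgt0Pr => e e0.
  (* [f] may be null, so it is normalised by a slightly larger number. *)
  pose q := ip Q f f + e / (V ^+ 2 + 1).
  have V1 : 0 < V ^+ 2 + 1 by rewrite ltr_wpDl// sqr_ge0.
  have q0 : 0 < q by rewrite ltr_wpDl ?ip_ge0// divr_gt0.
  have scaled c : c ^+ 2 = q^-1 -> c * (\int[X]_t phi f t) <= V.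
    move=> c2; have ccf := coord_space_leZ c cf.
    have := CAdv_ge ccf; rewrite VE lee_fin.
    have -> : phi (fun y => c * f y) = fun t => c * phi f t.
      by apply/funext => t; rewrite /phi ipZl.
    rewrite meanZ//; apply.
    rewrite ipZl//; last exact: L2Z.
    rewrite ipC ipZl// mulrA -expr2 c2 mulrC ler_pdivrMr// mul1r /q lerDl.
    by rewrite divr_ge0// ltW.
  have [qs0 qs2] : 0 < Num.sqrt q /\ Num.sqrt q ^+ 2 = q.
    by rewrite sqrtr_gt0 q0 sqr_sqrtr// ltW.
  set m := \int[X]_t phi f t.
  have m1 : `|m| <= V * Num.sqrt q.
    have m_le : m <= V * Num.sqrt q.
      by rewrite -ler_pdivrMr// mulrC; apply: scaled; rewrite exprVn qs2.
    have mN_le : - m <= V * Num.sqrt q.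
      rewrite -ler_pdivrMr// mulNr mulrC -mulNr; apply: scaled.
      by rewrite sqrrN exprVn qs2.
    by rewrite ler_norml lerNl mN_le.
  have : m ^+ 2 <= V ^+ 2 * q.
    rewrite -[m ^+ 2]real_normK ?num_real// -qs2 -exprMn ler_pXn2r// nnegrE//.
    by rewrite mulr_ge0// ltW.
  move=> /le_trans; apply; rewrite /q mulrDr lerD2l mulrA ler_pdivrMr//.
  by rewrite mulrDr mulr1 mulrC lerDl ltW.
pose psi t := \int[X]_t' K (t, t').
have psi_mean : \int[X]_t psi t = S by rewrite /S mean_product.
have bpsi : bmeas psi by exact: bmeas_partial_mean.
have bpp : bmeas (fun z : T * T => psi z.1 * psi z.2).
  by apply: bmeasM; [exact: bmeas_fst|exact: bmeas_snd].
have psi_sample s : \sum_(t <- s) psi t = \int[X]_t' phi (sample s) t'.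
  rewrite -mean_sum; last by move=> t _; exact: bmeas_section.
  apply: eq_Rintegral => t' _; rewrite /phi ipC ip_sample//.
  by apply: eq_bigr => t _; rewrite /phi KE ipC.
have S2 : S ^+ 2 <= V ^+ 2 * S.
  rewrite -{1}psi_mean -subr_ge0 [X in _ - X]expr2 -mean_tensor// -meanZ//.
  rewrite -meanB//; last exact: bmeasZ.
  apply: psd_mean_ge0 => [|t t'|s] /=.
  - by apply: bmeasB => //; exact: bmeasZ.
  - by rewrite Ksym [psi t * _]mulrC.
  under eq_bigr => t _ do rewrite sumrB -!mulr_sumr.
  rewrite sumrB -mulr_sumr gram -mulr_suml -[X in _ - X]expr2 psi_sample subr_ge0.
  exact/mean_le_V/coord_space_le_sample.
suff SV : S = V ^+ 2 by rewrite VE -[RHS]/(S%:E) SV EFin_expe.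
apply/eqP; rewrite eq_le VS andbT.
have [->|S_neq0] := eqVneq S 0; first exact: sqr_ge0.
have S_gt0 : 0 < S by rewrite lt_def S_neq0.
by move: S2; rewrite expr2 ler_pM2r.
Qed.

End coordinate_advantage.

(** * Power sums of the diluted overlaps *)

Section diluted_power_sums.
Context (R : realType).

Lemma sum_dilution_index (k N : nat) (f : 'I_N -> R) :
  \sum_(j < k * N) f (dilution_index j) = k%:R * \sum_(i < N) f i.
Proof.
case: N f => [|N] f.
  by rewrite [in RHS]big_ord0 mulr0 big1// => -[j jk]; exfalso; move: jk; rewrite muln0.
pose g (n : nat) := f (inord n).
have -> : \sum_(j < k * N.+1) f (dilution_index j) =
    \sum_(0 <= j < k * N.+1) g (j %/ k)%N.
  rewrite big_mkord; apply: eq_bigr => j _; rewrite /g; congr f.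
  by apply: val_inj; rewrite /= inordK// dilution_index_subproof.
have -> : \sum_(i < N.+1) f i = \sum_(0 <= i < N.+1) g i.
  by rewrite big_mkord; apply: eq_bigr => i _; rewrite /g inord_val.
elim: (N.+1) => [|n IH]; first by rewrite muln0 !big_geq// mulr0.
have [->|k0] := posnP k; first by rewrite mul0n big_geq// mul0r.
rewrite big_nat_recr//= mulrDr -IH mulnS addnC.
rewrite (@big_cat_nat _ _ _ (k * n))//= ?leq_addr//.
congr (_ + _); rewrite -{1}[(k * n)%N]add0n big_addn addnC addnK.
rewrite [RHS]mulr_natl -[X in _ *+ X]subn0 -sumr_const_nat.
apply: eq_big_nat => j /andP[_ jk]; congr g.
by rewrite addnC mulnC divnMDl// divn_small// addn0.
Qed.

Variables (K : R -> R -> R) (A F C b4 : R).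
Hypothesis A0 : 0 < A.
Hypothesis C0 : 0 <= C.
Hypothesis b40 : 0 <= b4.
Hypothesis KF : forall a b, `|a| <= A -> `|b| <= A ->
  `|K a b - F * (a * b)| <= C * (`|a * b| * (a ^+ 2 + b ^+ 2)).

Let C1 := `|F| + 2 * C * A ^+ 2.

(** The first summand dominates, for every [m >= 2], the [m]-th root of
[C1 ^ m (A ^ 2) ^ (m - 2) b4], which comes from the [m]-th power sum; the second
one comes from the first power sum. *)
Definition dilution_constant : R :=
  (1 + C1) * (1 + A ^+ 2) * (1 + b4) + 2 * C * b4.

Let A20 : 0 <= A ^+ 2. Proof. exact: sqr_ge0. Qed.

Let C10 : 0 <= C1.
Proof. exact: addr_ge0 (normr_ge0 F) (mulr_ge0 (mulr_ge0 (ler0n _ 2) C0) A20). Qed.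

Let C1p : 0 <= 1 + C1. Proof. exact: addr_ge0. Qed.

Let A2p : 0 <= 1 + A ^+ 2. Proof. exact: addr_ge0. Qed.

Let main_ge0 : 0 <= (1 + C1) * (1 + A ^+ 2) * (1 + b4).
Proof. by apply: mulr_ge0; [apply: mulr_ge0|]; exact: addr_ge0. Qed.

Let rest_ge0 : 0 <= 2 * C * b4.
Proof. exact: mulr_ge0 (mulr_ge0 (ler0n _ 2) C0) b40. Qed.

Lemma dilution_constant_ge0 : 0 <= dilution_constant.
Proof. exact: addr_ge0 main_ge0 rest_ge0. Qed.

Let K_bound a b : `|a| <= A -> `|b| <= A -> `|K a b| <= C1 * `|a * b|.
Proof.
move=> aA bA; rewrite -[K a b](subrK (F * (a * b))).
apply: (le_trans (ler_normD _ _)); apply: (le_trans (lerD (KF aA bA) (lexx _))).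
rewrite (normrM F) /C1 mulrDl [leRHS]addrC lerD2r.
have a2 : a ^+ 2 <= A ^+ 2.
  by rewrite -[a ^+ 2]real_normK ?num_real// ler_pXn2r// nnegrE// ltW.
have b2 : b ^+ 2 <= A ^+ 2.
  by rewrite -[b ^+ 2]real_normK ?num_real// ler_pXn2r// nnegrE// ltW.
have -> : 2 * C * A ^+ 2 * `|a * b| = C * (`|a * b| * (A ^+ 2 + A ^+ 2)) by ring.
by rewrite ler_wpM2l// ler_wpM2l// lerD.
Qed.

Variables (N k : nat).
Hypothesis k1 : (1 <= k)%N.
Variables x x' : N.-tuple R.
Hypothesis xA : forall i, `|tnth x i| <= A.
Hypothesis x'A : forall i, `|tnth x' i| <= A.
Hypothesis x4 : \sum_(i < N) tnth x i ^+ 4 <= b4.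
Hypothesis x'4 : \sum_(i < N) tnth x' i ^+ 4 <= b4.

Let s : R := Num.sqrt k%:R.

Let s2 : s ^+ 2 = k%:R.
Proof. by rewrite sqr_sqrtr. Qed.

Let s1 : 1 <= s.
Proof. by rewrite -[leLHS]sqrtr1 ler_sqrt ?ler1n// ltr0n. Qed.

Let s0 : 0 < s.
Proof. exact: lt_le_trans ltr01 s1. Qed.

Lemma normr_dilute_le (z : N.-tuple R) : (forall i, `|tnth z i| <= A) ->
  forall j, `|tnth (dilute k z) j| <= A.
Proof.
move=> zA j; rewrite tnth_mktuple normrM normfV (ger0_norm (ltW s0)) -/s.
rewrite mulrC ler_pdivrMr// (le_trans (zA _))// ler_peMr//.
exact: ltW.
Qed.

Let r (j : 'I_(k * N)) := K (tnth (dilute k x) j) (tnth (dilute k x') j).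

Let psumE m :
  psum r m = k%:R * \sum_(i < N) K (s^-1 * tnth x i) (s^-1 * tnth x' i) ^+ m.
Proof.
rewrite -sum_dilution_index; apply: eq_bigr => j _.
by rewrite /r !tnth_mktuple.
Qed.

Let scaled_le (z : R) : `|z| <= A -> `|s^-1 * z| <= A.
Proof.
move=> zA; rewrite normrM normfV (ger0_norm (ltW s0)) mulrC ler_pdivrMr//.
by rewrite (le_trans zA)// ler_peMr// ltW.
Qed.

Let quartic (a b : R) : `|a * b| * (a ^+ 2 + b ^+ 2) <= a ^+ 4 + b ^+ 4.
Proof.
rewrite normrM -[a ^+ 2]real_normK ?num_real// -[b ^+ 2]real_normK ?num_real//.
rewrite (_ : a ^+ 4 = `|a| ^+ 4); last by rewrite -normrX ger0_norm// exprn_even_ge0.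
rewrite (_ : b ^+ 4 = `|b| ^+ 4); last by rewrite -normrX ger0_norm// exprn_even_ge0.
move: (normr_ge0 a) (normr_ge0 b); move: `|a| `|b| => u v u0 v0.
rewrite -subr_ge0.
have -> : u ^+ 4 + v ^+ 4 - u * v * (u ^+ 2 + v ^+ 2) =
  (u - v) ^+ 2 * (u ^+ 2 + u * v + v ^+ 2) by ring.
by rewrite mulr_ge0 ?sqr_ge0// !addr_ge0 ?sqr_ge0// mulr_ge0.
Qed.

(** Each coordinate is repeated [k] times with both signals divided by [sqrt k], so
the quartic error of the expansion is divided by [k]. *)
Lemma diluted_psum1 :
  `|psum r 1 - F * dotp x x'| <= dilution_constant / s.
Proof.
rewrite psumE /dotp !mulr_sumr -sumrB.
apply: (le_trans (ler_norm_sum _ _ _)).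
apply: (@le_trans _ _ (\sum_(i < N) C / k%:R * (tnth x i ^+ 4 + tnth x' i ^+ 4))).
  apply: ler_sum => i _; set a := tnth x i; set b := tnth x' i.
  rewrite expr1.
  have sa : `|s^-1 * a| <= A := scaled_le (xA i).
  have sb : `|s^-1 * b| <= A := scaled_le (x'A i).
  have -> : k%:R * K (s^-1 * a) (s^-1 * b) - F * (a * b) =
      k%:R * (K (s^-1 * a) (s^-1 * b) - F * (s^-1 * a * (s^-1 * b))).
    by rewrite -s2; field; rewrite gt_eqF.
  rewrite normrM normr_nat.
  apply: (le_trans (ler_wpM2l (ler0n _ k) (KF sa sb))).
  have -> : `|s^-1 * a * (s^-1 * b)| = (s ^+ 2)^-1 * `|a * b|.
    rewrite mulrACA normrM; congr (_ * _).
    by rewrite -invfM -expr2 ger0_norm// invr_ge0 sqr_ge0.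
  have -> : k%:R * (C * ((s ^+ 2)^-1 * `|a * b| *
        ((s^-1 * a) ^+ 2 + (s^-1 * b) ^+ 2))) =
      C / k%:R * (`|a * b| * (a ^+ 2 + b ^+ 2)).
    by rewrite -s2; field; rewrite gt_eqF.
  by rewrite ler_wpM2l// divr_ge0.
rewrite -mulr_sumr big_split/=.
apply: (@le_trans _ _ (C / k%:R * (b4 + b4))).
  by rewrite ler_wpM2l// ?divr_ge0// lerD.
apply: (@le_trans _ _ (C / s * (b4 + b4))).
  rewrite ler_wpM2r ?addr_ge0// ler_wpM2l// lef_pV2 ?posrE ?ltr0n//.
  by rewrite -s2 expr2 ler_peMr// ltW.
rewrite mulrAC; apply: ler_wpM2r; first by rewrite invr_ge0 ltW.
rewrite /dilution_constant.
rewrite (_ : C * (b4 + b4) = 2 * C * b4); last by ring.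
by rewrite lerDr.
Qed.

(** The sum of the [m]-th powers is of order [k ^ (1 - m)], and
[m - 1 >= m / 2]. *)
Lemma diluted_psum m : (2 <= m)%N -> `|psum r m| <= (dilution_constant / s) ^+ m.
Proof.
case: m => // -[//|n _]; rewrite psumE normrM normr_nat.
have step i : `|K (s^-1 * tnth x i) (s^-1 * tnth x' i) ^+ n.+2| <=
    (C1 / k%:R) ^+ n.+2 * (A ^+ 2) ^+ n * ((tnth x i ^+ 4 + tnth x' i ^+ 4) / 2).
  set a := tnth x i; set b := tnth x' i.
  rewrite normrX.
  have H : `|K (s^-1 * a) (s^-1 * b)| <= C1 / k%:R * `|a * b|.
    apply: (le_trans (K_bound (scaled_le (xA i)) (scaled_le (x'A i)))).
    rewrite mulrACA normrM -invfM -expr2 s2 mulrA ler_wpM2r//.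
    by rewrite ger0_norm// invr_ge0.
  apply: (@le_trans _ _ ((C1 / k%:R * `|a * b|) ^+ n.+2)).
    by rewrite ler_pXn2r// nnegrE// mulr_ge0// divr_ge0.
  rewrite exprMn -mulrA ler_wpM2l ?exprn_ge0 ?divr_ge0//.
  rewrite -addn2 exprD; apply: ler_pM; rewrite ?exprn_ge0//.
    apply: lerXn2r; rewrite ?nnegrE//.
    by rewrite normrM expr2 ler_pM// ?xA ?x'A.
  rewrite real_normK ?num_real// ler_pdivlMr//.
  rewrite -subr_ge0.
  have -> : a ^+ 4 + b ^+ 4 - (a * b) ^+ 2 * 2 = (a ^+ 2 - b ^+ 2) ^+ 2 by ring.
  exact: sqr_ge0.
have sum_le : `|\sum_(i < N) K (s^-1 * tnth x i) (s^-1 * tnth x' i) ^+ n.+2| <=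
    (C1 / k%:R) ^+ n.+2 * (A ^+ 2) ^+ n * b4.
  apply: (le_trans (ler_norm_sum _ _ _)).
  apply: (@le_trans _ _ (\sum_(i < N) (C1 / k%:R) ^+ n.+2 * (A ^+ 2) ^+ n *
      ((tnth x i ^+ 4 + tnth x' i ^+ 4) / 2))).
    by apply: ler_sum => i _; exact: step.
  rewrite -mulr_sumr -mulr_suml big_split/=; apply: ler_wpM2l.
    by apply: mulr_ge0; apply: exprn_ge0 => //; exact: divr_ge0.
  by rewrite ler_pdivrMr// (le_trans (lerD x4 x'4))// mulr_natr mulr2n.
apply: (le_trans (ler_wpM2l (ler0n _ k) sum_le)).
have C3 : C1 ^+ n.+2 * (A ^+ 2) ^+ n * b4 <= dilution_constant ^+ n.+2.
  apply: (@le_trans _ _ (((1 + C1) * (1 + A ^+ 2) * (1 + b4)) ^+ n.+2)); last first.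
    apply: lerXn2r; rewrite ?nnegrE ?main_ge0 ?dilution_constant_ge0//.
    by rewrite /dilution_constant lerDl.
  rewrite [leRHS]exprMn [X in _ <= X * _]exprMn; apply: ler_pM => //.
  - by apply: mulr_ge0; exact: exprn_ge0.
  - apply: ler_pM; [exact: exprn_ge0|exact: exprn_ge0| |].
      by apply: lerXn2r; rewrite ?nnegrE ?C1p// lerDr.
    apply: (@le_trans _ _ ((1 + A ^+ 2) ^+ n)).
      by apply: lerXn2r; rewrite ?nnegrE ?A2p ?A20// lerDr.
    by rewrite ler_weXn2l// ?lerDl ?A20// leqW.
  rewrite -[leLHS]expr1; apply: (@le_trans _ _ ((1 + b4) ^+ 1)).
    by rewrite !expr1 lerDr.
  by rewrite ler_weXn2l// lerDl.
rewrite !expr_div_n -s2 -(exprM s 2 n.+2).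
have -> : s ^+ 2 * (C1 ^+ n.+2 / s ^+ (2 * n.+2) * (A ^+ 2) ^+ n * b4) =
    (C1 ^+ n.+2 * (A ^+ 2) ^+ n * b4) / s ^+ (n + n.+2).
  have -> : (2 * n.+2 = 2 + (n + n.+2))%N by rewrite mul2n -addnn addSn.
  by rewrite exprD; field; rewrite expf_neq0 gt_eqF.
apply: ler_pM => //.
- by apply: mulr_ge0 => //; apply: mulr_ge0; exact: exprn_ge0.
- by rewrite invr_ge0 exprn_ge0 ?ltW.
by rewrite lef_pV2 ?posrE ?exprn_gt0// ler_weXn2l// leq_addl.
Qed.

End diluted_power_sums.

(** * Comparison with the universal advantage *)

Section retraction.
Context (R : realType) (N : nat) (A b4 : R).
Hypothesis A0 : 0 <= A.
Hypothesis b40 : 0 <= b4.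

Definition bounded_signal : set (N.-tuple R) :=
  [set x | (forall i, `|tnth x i| <= A) /\ \sum_(i < N) tnth x i ^+ 4 <= b4].

Let measurable_le (f : N.-tuple R -> R) c : measurable_fun setT f ->
  measurable [set x | f x <= c].
Proof.
move=> mf; rewrite (_ : [set x | _] = f @^-1` `]-oo, c]); last first.
  by apply/seteqP; split => x /=; rewrite in_itv.
by rewrite -[X in measurable X]setTI; exact: mf.
Qed.

Lemma measurable_bounded_signal : measurable bounded_signal.
Proof.
rewrite (_ : bounded_signal =
    (\bigcap_(i in [set: 'I_N]) [set x : N.-tuple R | `|tnth x i| <= A]) `&`
    [set x : N.-tuple R | \sum_(i < N) tnth x i ^+ 4 <= b4]); last first.
  apply/seteqP; split => x /= [H1 H2]; split => // i; first by move=> _; exact: H1.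
  exact: H1.
apply: measurableI.
  apply: fin_bigcap_measurable => // i _; apply: measurable_le.
  by apply: measurableT_comp => //; exact: measurable_tnth.
apply: measurable_le; apply: measurable_sum => i.
by apply: measurable_funX; exact: measurable_tnth.
Qed.

(** Replacing atypical signals by 0 changes the prior on a null set only, and makes
its bounds hold everywhere. *)
Definition retract (x : N.-tuple R) : N.-tuple R :=
  [tuple \1_bounded_signal x * tnth x i | i < N].

Lemma retract_id x : bounded_signal x -> retract x = x.
Proof.
move=> xG; apply: eq_from_tnth => i.
by rewrite tnth_mktuple indicE mem_set// mul1r.
Qed.

Lemma retract_bounded x : bounded_signal (retract x).
Proof.
have [xG|xG] := pselect (bounded_signal x); first by rewrite retract_id.
have r0 i : tnth (retract x) i = 0 by rewrite tnth_mktuple indicE memNset// mul0r.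
split => [i|]; first by rewrite r0 normr0.
by rewrite big1// => i _; rewrite r0 expr0n.
Qed.

Lemma measurable_retract : measurable_fun setT retract.
Proof.
apply/measurable_fun_tnthP => i.
rewrite (_ : _ \o _ = fun x : N.-tuple R => \1_bounded_signal x * tnth x i).
  apply: measurable_funM; last exact: measurable_tnth.
  by apply: measurable_indic; exact: measurable_bounded_signal.
by apply/funext => x /=; rewrite tnth_mktuple.
Qed.

Lemma bmeas_retract i : bmeas (fun x => tnth (retract x) i).
Proof.
split; last by exists A => x; exact: (retract_bounded x).1.
exact: measurableT_comp (measurable_tnth i) measurable_retract.
Qed.

End retraction.

Section almost_sure_range.
Context (R : realType) (N : nat) (X : probability (N.-tuple R) R) (A B4 : R).
Hypothesis B40 : 0 < B4.
Hypothesis P1 : assumption_P1 A X.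
Hypothesis P4 : norm_bound 4 B4 X.

Let G := @bounded_signal R N A (B4 ^+ 4).

Lemma bounded_signal_null : X (~` G) = 0%E.
Proof.
have mG : measurable G by exact: measurable_bounded_signal.
apply/negligibleP; first exact: measurableC.
apply: filterS2 P1 P4 => x xA x4; split => [i|].
  by apply: le_trans xA; rewrite /norm_inf; exact: (le_bigmax _ (fun i => `|tnth x i|)).
move: x4; rewrite /norm_l subrr powRr0 mulr1.
set s := \sum_(i < N) `|tnth x i| ^+ 4 => H.
have -> : \sum_(i < N) tnth x i ^+ 4 = s.
  by apply: eq_bigr => i _; rewrite -normrX ger0_norm// exprn_even_ge0.
have s0 : 0 <= s by apply: sumr_ge0 => i _; rewrite exprn_ge0.
have -> : s = (s `^ (4%:R)^-1) ^+ 4.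
  by rewrite -powR_mulrn ?powR_ge0// -powRrM mulVf// powRr1.
by apply: lerXn2r; rewrite ?nnegrE ?powR_ge0// ltW.
Qed.

Lemma measure_eq_on_range (B1 B2 : set (N.-tuple R)) :
  measurable B1 -> measurable B2 -> (forall x, G x -> B1 x <-> B2 x) -> X B1 = X B2.
Proof.
have mG : measurable G by exact: measurable_bounded_signal.
suff H C1 C2 : measurable C1 -> measurable C2 -> (forall x, G x -> C1 x -> C2 x) ->
    (X C1 <= X C2)%E.
  move=> m1 m2 e; apply/eqP; rewrite eq_le; apply/andP.
  by split; apply: H => // x Gx; have [] := e x Gx.
move=> m1 m2 C12; rewrite -[leRHS]adde0 -[X in (_ + X)%E]bounded_signal_null.
apply: le_trans (measureU2 _ _ _) => //; last exact: measurableC.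
apply: le_measure; rewrite ?inE//; first exact: measurableU m2 (measurableC mG).
by move=> x C1x; have [Gx|nGx] := pselect (G x); [left; exact: C12|right].
Qed.

Lemma ae_bounded_signal2 :
  {ae (X \x X)%E, forall z : N.-tuple R * N.-tuple R, G z.1 /\ G z.2}.
Proof.
have mnG : measurable (~` G) by apply: measurableC; exact: measurable_bounded_signal.
exists ((~` G `*` setT) `|` (setT `*` ~` G)); split.
- by apply: measurableU; exact: measurableX.
- apply/eqP; rewrite eq_le measure_ge0 andbT.
  apply: (le_trans (measureU2 _ _ _)); [exact: measurableX|exact: measurableX|].
  have XG0 := bounded_signal_null.
  rewrite -[leRHS]adde0; apply: leeD; rewrite le_eqVlt; apply/orP; left; apply/eqP.
    apply: etrans (product_measure1E X X mnG measurableT) _.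
    by apply: etrans (mul0e _); congr (_ * _)%E.
  apply: etrans (product_measure1E X X measurableT mnG) _.
  by apply: etrans (mule0 _); congr (_ * _)%E.
move=> z /= /not_andP[H|H]; [left|right] => //.
Qed.

End almost_sure_range.

Section inner_product_moments.
Context d (T : measurableType d) (R : realType) (X : probability T R) (N : nat).
Variable q : T -> N.-tuple R.
Hypothesis bq : forall i, bmeas (fun t => tnth (q t) i).

Lemma bmeas_dotp : bmeas (fun z : T * T => dotp (q z.1) (q z.2)).
Proof.
rewrite /dotp; apply: bmeas_sum => i _; apply: bmeasM.
  exact: (bmeas_fst (bq i)).
exact: (bmeas_snd (bq i)).
Qed.

(** The [n]-th moment is the squared norm of the [n]-th moment tensor of the law of
[q]. *)
Lemma mean_dotp_ge0 n : 0 <= \int[(X \x X)%E]_z (dotp (q z.1) (q z.2) ^+ n).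
Proof.
apply: psd_mean_ge0 => [|t t'|s] /=.
- exact: bmeasX bmeas_dotp.
- by congr (_ ^+ _); apply: eq_bigr => i _; rewrite mulrC.
have E t t' : dotp (q t) (q t') ^+ n =
    \sum_(f : {ffun 'I_n -> 'I_N})
      (\prod_j tnth (q t) (f j)) * \prod_j tnth (q t') (f j).
  rewrite -[X in _ ^+ X]card_ord -prodr_const bigA_distr_bigA/=.
  by apply: eq_bigr => f _; rewrite -big_split.
under eq_bigr => t _ do under eq_bigr => t' _ do rewrite E.
under eq_bigr => t _ do rewrite exchange_big/=.
rewrite exchange_big/=; apply: sumr_ge0 => f _.
under eq_bigr => t _ do rewrite -mulr_sumr.
by rewrite -mulr_suml -expr2 sqr_ge0.
Qed.

End inner_product_moments.

Section channel_constants.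
Context d (Omega : measurableType d) (R : realType) (P : channel Omega R).

(** On the diagonal the overlap is a squared norm, and it is [F a ^ 2] up to order
[a ^ 4]. *)
Lemma Fisher_ge0 (A C : R) : 0 < A -> 0 <= C ->
  (forall a b, `|a| <= A -> `|b| <= A ->
    `|overlap P a b - Fisher P * (a * b)| <= C * (`|a * b| * (a ^+ 2 + b ^+ 2))) ->
  0 <= Fisher P.
Proof.
move=> A0 C0 H; rewrite leNgt; apply/negP => F0.
have C1 : 0 < 2 * C + 1 by rewrite ltr_wpDl// mulr_ge0.
have e0 : 0 < - Fisher P / (2 * C + 1) by rewrite divr_gt0// oppr_gt0.
pose a := Num.min A (Num.min 1 (- Fisher P / (2 * C + 1))).
have a0 : 0 < a by rewrite !lt_min A0 ltr01.
have aA : `|a| <= A by rewrite gtr0_norm// ge_min lexx.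
have a1 : a <= 1 by rewrite !ge_min lexx orbT.
have aF : a * (2 * C + 1) <= - Fisher P.
  by rewrite -ler_pdivlMr// !ge_min lexx !orbT.
have := H a a aA aA; have := overlap_diag_ge0 P a.
have aa0 : 0 < a * a by rewrite mulr_gt0.
rewrite (gtr0_norm aa0) ler_norml => o0 /andP[_ oF].
move: oF; rewrite lerBlDr => /(le_trans o0).
have -> : C * (a * a * (a ^+ 2 + a ^+ 2)) + Fisher P * (a * a) =
  (2 * C * a ^+ 2 + Fisher P) * (a * a) by ring.
rewrite pmulr_lge0 ?mulr_gt0// => K.
have : 2 * C * a ^+ 2 <= 2 * C * a.
  by rewrite ler_wpM2l ?mulr_ge0// expr2 ler_piMr// ltW.
lra.
Qed.

End channel_constants.

Section weighted_comparison.
Context (R : realType).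

(** For nonnegative terms, damping the [d]-th one by [lam ^ d] changes the sum by at
most the factor [lam ^ D]. *)
Lemma weighted_comparison (E U : nat -> R) (lam : R) D :
  0 < lam <= 1 -> (forall d, 0 <= E d) -> (forall d, 0 <= U d) ->
  `|\sum_(d < D.+1) lam ^+ d * E d - \sum_(d < D.+1) lam ^+ d * U d| <=
    2^-1 * \sum_(d < D.+1 | ~~ odd d) lam ^+ d * U d ->
  2^-1 * lam ^+ D * \sum_(d < D.+1) U d <= \sum_(d < D.+1) E d /\
  \sum_(d < D.+1) E d <= 3 / 2 / lam ^+ D * \sum_(d < D.+1) U d.
Proof.
move=> /andP[lam0 lam1] E0 U0 H.
have damp (V : nat -> R) : (forall d, 0 <= V d) ->
    lam ^+ D * \sum_(d < D.+1) V d <= \sum_(d < D.+1) lam ^+ d * V d /\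
    \sum_(d < D.+1) lam ^+ d * V d <= \sum_(d < D.+1) V d.
  move=> V0; split.
    rewrite mulr_sumr; apply: ler_sum => d _; apply: ler_wpM2r => //.
    by apply: ler_wiXn2l => //; [exact: ltW|rewrite -ltnS].
  apply: ler_sum => d _; apply: ler_piMl => //.
  by apply: exprn_ile1 => //; exact: ltW.
have even_le : \sum_(d < D.+1 | ~~ odd d) lam ^+ d * U d <=
    \sum_(d < D.+1) lam ^+ d * U d.
  rewrite big_mkcond/=; apply: ler_sum => d _; case: ifP => // _.
  by rewrite mulr_ge0// exprn_ge0// ltW.
have [E1 E2] := damp E E0; have [U1 U2] := damp U U0.
have lD : 0 < lam ^+ D by rewrite exprn_gt0.
move: H; rewrite ler_norml => /andP[H1 H2].
split; first by rewrite -mulrA; lra.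
rewrite mulrAC ler_pdivlMr// mulrC; lra.
Qed.

End weighted_comparison.

Theorem theorem3p17 (R : realType) (d : measure_display)
    (Omega : measurableType d) (P : channel Omega R) (A B2 B4 B6 : R)
    (hA : 0 < A) (hB2 : 0 < B2) (hB4 : 0 < B4) (hB6 : 0 < B6)
    (hgood : good P) (hC1 : assumption_C1 P A) (hC2 : assumption_C2 P) :
  exists c1 c2 : R, [/\ 0 < c1, 0 < c2 &
    forall (N : nat) (X : probability (N.-tuple R) R) (k D : nat),
      (1 <= N)%N -> is_prior P X ->
      assumption_P1 A X -> assumption_P2 B2 B4 B6 X ->
      (1 <= k)%N -> (D ^ 2 <= k)%N ->
      (c1%:E * Univ D X (Fisher P)^-1 <= CAdv P D (dilution k X) ^+ 2)%E /\
      (CAdv P D (dilution k X) ^+ 2 <= c2%:E * Univ D X (Fisher P)^-1)%E].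
Proof.
have [U [oU sU Usig ckU]] := hC1.
have [C C0 KF] := bilinear_expansion hA oU sU ckU (overlapC P) (overlap0 hgood) hC2.
rewrite -/(Fisher P) in KF.
have F0 := Fisher_ge0 hA C0 KF.
have b40 : 0 <= B4 ^+ 4 by rewrite exprn_ge0// ltW.
pose c := dilution_constant A (Fisher P) C (B4 ^+ 4).
have c0 : 0 <= c by exact: dilution_constant_ge0.
(* [12 c / s <= 1] is the smallness needed of the majorant when [lam = 1]. *)
pose n0 := (Num.bound (12 * c)).+1.
have n0c : 12 * c <= n0%:R.
  have := archi_boundP (mulr_ge0 (ler0n R 12) c0) => /ltW/le_trans; apply.
  by rewrite ler_nat.
have n00 : 0 < n0%:R :> R by rewrite ltr0n.
have n01 : 1 <= n0%:R :> R by rewrite ler1n.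
exists (2^-1 / n0%:R ^+ n0), (3 / 2 * n0%:R ^+ n0); split.
- by rewrite divr_gt0// exprn_gt0.
- by rewrite mulr_gt0// exprn_gt0.
move=> N X k D N1 _ hP1 [_ hP4 _] k1 Dk.
pose s : R := Num.sqrt k%:R.
have s2 : s ^+ 2 = k%:R by rewrite sqr_sqrtr.
have s1 : 1 <= s by rewrite -[leLHS]sqrtr1 ler_sqrt ?ler1n// ltr0n.
have s0 : 0 < s by exact: lt_le_trans s1.
(* The damping factor makes [lam * (c / s)] small; a factor smaller than 1 is
   used only when [k], and with it [D], is bounded. *)
have [lam [lam01 lamth lamD]] : exists lam : R, [/\ 0 < lam <= 1,
    lam * (c / s) <= 12^-1 & (n0%:R ^+ n0)^-1 <= lam ^+ D].
  have [sn0|sn0] := leP n0%:R s.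
    exists 1; split; first by rewrite ltr01 lexx.
      rewrite mul1r ler_pdivrMr// mulrC ler_pdivlMr// mulrC.
      exact: le_trans n0c sn0.
    by rewrite expr1n invf_le1 ?exprn_gt0// exprn_ege1.
  have Dn0 : (D <= n0)%N.
    rewrite leqNgt; apply/negP => n0D.
    have : n0%:R ^+ 2 <= s ^+ 2.
      rewrite s2 -natrX ler_nat; apply: leq_trans Dk.
      by rewrite leq_exp2r// ltnW.
    by rewrite ler_pXn2r ?nnegrE ?(ltW s0)// leNgt sn0.
  exists n0%:R^-1; split.
  - by rewrite invr_gt0 n00 invf_le1.
  - rewrite mulrC ler_pdivrMr// ler_pdivrMr//.
    have : 12^-1 * n0%:R <= 12^-1 * n0%:R * s by rewrite ler_peMr// mulr_ge0.
    apply: le_trans; rewrite mulrC ler_pdivlMr// mulrC; exact: n0c.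
  by rewrite exprVn lef_pV2 ?posrE ?exprn_gt0// ler_weXn2l.
pose rho := @retract R N A (B4 ^+ 4).
have rhoG := @retract_bounded R N A (B4 ^+ 4) (ltW hA) b40.
pose r x := dilute k (rho x).
have mrho : measurable_fun setT rho by exact: measurable_retract.
have mr : measurable_fun setT r.
  exact: (measurableT_comp (@measurable_dilute R N k) mrho).
have rA x i : `|tnth (r x) i| <= A.
  by apply: normr_dilute_le => //; exact: (rhoG x).1.
have X0E B : measurable B -> dilution k X B = X (r @^-1` B).
  move=> mB; apply: (measure_eq_on_range hB4 hP1 hP4).
  - by rewrite -[X in measurable X]setTI; exact: measurable_dilute.
  - by rewrite -[X in measurable X]setTI; exact: mr.
  by move=> x Gx; rewrite /preimage/= /r /rho retract_id.
have cK p : U p -> {for p, continuous (fun q : R * R => overlap P q.1 q.2)}.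
  exact: ckU.1.
have E0 := mean_overlap_elem_sym_ge0 hgood hA sU Usig cK X mr rA.
rewrite (CAdv_sqr hgood hA sU Usig cK mr rA X0E).
pose e n (z : N.-tuple R * N.-tuple R) :=
  elem_sym (fun i => overlap P (tnth (r z.1) i) (tnth (r z.2) i)) n.
pose u n (z : N.-tuple R * N.-tuple R) :=
  exp_term (Fisher P * dotp (rho z.1) (rho z.2)) n.
have be n : bmeas (e n).
  apply: (bmeas_overlap_elem_sym hA sU cK mr rA); first exact: measurable_fst.
  exact: measurable_snd.
have bdotp : bmeas (fun z : N.-tuple R * N.-tuple R => dotp (rho z.1) (rho z.2)).
  by apply: bmeas_dotp => i; exact: (bmeas_retract (ltW hA) b40).
have uE n : u n = fun z => Fisher P ^+ n / n`!%:R * dotp (rho z.1) (rho z.2) ^+ n.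
  by apply/funext => z; rewrite /u exp_termM /exp_term mulrCA mulrC mulrAC.
have bu n : bmeas (u n) by rewrite uE; exact: bmeasZ (bmeasX n bdotp).
pose Xm n := \int[(X \x X)%E]_z e n z.
pose Um n := \int[(X \x X)%E]_z u n z.
have Um0 n : 0 <= Um n.
  rewrite /Um uE meanZ; last exact: bmeasX.
  rewrite mulr_ge0 ?divr_ge0 ?exprn_ge0//.
  by apply: mean_dotp_ge0 => i; exact: (bmeas_retract (ltW hA) b40).
have -> : \int[(X \x X)%E]_z overlap_kernel P D (r z.1) (r z.2) = \sum_(n < D.+1) Xm n.
  by rewrite -mean_sum.
have -> : (Univ D X (Fisher P)^-1 = (\sum_(n < D.+1) Um n)%:E)%E.
  have bus : bmeas (fun z => \sum_(n < D.+1) u n z) by apply: bmeas_sum.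
  rewrite -mean_sum// -EFin_Rintegral; last exact: bmeas_integrable.
  rewrite /Univ expectation.unlock; apply: ae_eq_integral => //.
  - apply/measurable_EFinP; rewrite /exp_le; apply: measurable_sum => n.
    apply: measurable_funM => //; apply: measurable_funX; apply: measurable_funM => //.
    rewrite /dotp; apply: measurable_sum => i; apply: measurable_funM.
      exact: measurableT_comp (measurable_tnth i) measurable_fst.
    exact: measurableT_comp (measurable_tnth i) measurable_snd.
  - by apply/measurable_EFinP; exact: bus.1.
  apply: filterS (ae_bounded_signal2 hB4 hP1 hP4) => z [G1 G2] _ /=.
  by rewrite /exp_le /u /rho !retract_id// invrK.
have Hcmp : `|\sum_(n < D.+1) lam ^+ n * Xm n - \sum_(n < D.+1) lam ^+ n * Um n| <=
    2^-1 * \sum_(n < D.+1 | ~~ odd n) lam ^+ n * Um n.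
  have point z :
      `|\sum_(n < D.+1) lam ^+ n * e n z - \sum_(n < D.+1) lam ^+ n * u n z| <=
      2^-1 * \sum_(n < D.+1 | ~~ odd n) lam ^+ n * u n z.
    have [[x1 x4] [x1' x4']] := (rhoG z.1, rhoG z.2).
    apply: (@elem_sym_exp_sum _ _ _ _ (c / s)).
    - by rewrite divr_ge0// ltW.
    - by case/andP: lam01 => /ltW.
    - exact: lamth.
    - exact: diluted_psum1.
    - by move=> m m2; exact: diluted_psum.
  have bsum (p : pred 'I_D.+1) (f : nat -> N.-tuple R * N.-tuple R -> R) :
      (forall n, bmeas (f n)) ->
      bmeas (fun z => \sum_(n < D.+1 | p n) lam ^+ n * f n z).
    by move=> bf; apply: bmeas_sum => n _; exact: bmeasZ.
  have msum (p : pred 'I_D.+1) (f : nat -> N.-tuple R * N.-tuple R -> R) :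
      (forall n, bmeas (f n)) ->
      \int[(X \x X)%E]_z (\sum_(n < D.+1 | p n) lam ^+ n * f n z) =
      \sum_(n < D.+1 | p n) lam ^+ n * \int[(X \x X)%E]_z f n z.
    move=> bf; rewrite mean_sum; last by move=> n _; exact: bmeasZ.
    by apply: eq_bigr => n _; rewrite meanZ.
  rewrite -(msum xpredT _ be) -(msum xpredT _ bu) -(msum (fun n => ~~ odd n) _ bu).
  rewrite -(meanZ _ _ (bsum _ _ bu)) -(meanB _ (bsum _ _ be) (bsum _ _ bu)).
  apply: (le_trans (le_normr_Rintegral _ _)) => //.
    by apply: bmeas_integrable; apply: bmeasB; exact: bsum.
  apply: mean_le => //; first by apply: bmeas_norm; apply: bmeasB; exact: bsum.
  by apply: bmeasZ; exact: bsum.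
have [lower upper] := weighted_comparison lam01 E0 Um0 Hcmp.
have Usum0 : 0 <= \sum_(n < D.+1) Um n by apply: sumr_ge0 => n _; exact: Um0.
have lD : 0 < lam ^+ D by rewrite exprn_gt0//; case/andP: lam01.
rewrite -!EFinM !lee_fin; split.
  by apply: le_trans lower; rewrite ler_wpM2r// ler_wpM2l.
apply: (le_trans upper); rewrite ler_wpM2r// ler_wpM2l//.
by rewrite -[leRHS]invrK lef_pV2 ?posrE ?lD ?invr_gt0 ?exprn_gt0.
Qed.
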